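(* Let $R$ be a standard graded polynomial ring over a field. Let $\mathcal P$ be a regular CW complex supporting the linear strand of some monomial ideal $I\subseteq R$, and assume that every $1$-dimensional face of $\mathcal P$ has a unique multidegree (distinct $1$-dimensional faces have distinct multidegrees). Then the linear strand of any monomial ideal $J$ with $G(J)\subseteq G(I)$ is supported on the CW complex induced by restricting $\mathcal P$ to the vertices corresponding to generators of $J$. In particular, if $J$ has a linear minimal free resolution, then $J$ has a CW minimal free resolution.
   Context: $G(I)$ is the unique minimal monomial generating set of a monomial ideal $I$. Linear strand: if $F_\bullet$ is the minimal graded free resolution of a module with initial degree $d$ (so $F_0$ has initial degree $d$), its linear strand $F_\bullet^{\mathrm{lin}}$ is the subcomplex whose $i$-th term is the free summand of $F_i$ generated in degree $d+i$, with the restricted differential. Supporting: let $\mathcal P$ be a finite regular CW complex with incidence function $\epsilon$, whose vertices $v$ are labelled by monomials $m_v$; each face $P$ is labelled by its multidegree $m_P=\operatorname{lcm}(m_v\mid v\in V(P))$, where $V(P)$ is the vertex set of $P$. The associated complex has a free basis element $e_P$ of multidegree $m_P$ for each face $P$ (faces of dimension $i$ in homological degree $i$, when resolving an ideal; vertices correspond to generators), with differential $e_P\mapsto\sum_{Q}\epsilon(Q,P)\frac{m_P}{m_Q}e_Q$, sum over codimension-one faces $Q$ of $P$. $\mathcal P$ supports a complex if that complex is isomorphic to the associated one. A CW minimal free resolution is a minimal free resolution supported on a regular CW complex. For a set $\mathcal X$ of vertices, the induced subcomplex of $\mathcal P$ on $\mathcal X$ is $\{P\in\mathcal P\mid V(P)\subseteq\mathcal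 X\}$.
   Formalization: It is additionally assumed that J, if nonzero, has the same initial degree as I; otherwise the claim fails, e.g. I=(x²,y³), J=(y³), where no vertex of the complex corresponds to a generator of J but the linear strand of J is nonzero. *)

(* Defs.v *)
From HB Require Import structures.
From mathcomp Require Import all_boot all_order all_algebra.
From mathcomp Require boolp classical_sets reals topology normedtype.
From mathcomp Require mpoly.

Set Implicit Arguments.
Unset Strict Implicit.
Unset Printing Implicit Defensive.

Import GRing.Theory.
Local Open Scope ring_scope.

(* The topological library and the library of multivariate polynomials declare
   incompatible notations: each is imported in a module of its own. *)
Module CWComplex.
Import boolp classical_sets reals topology normedtype.
Import numFieldTopology.Exports.
Local Open Scope classical_set_scope.

Definition closed_unit_ball (T : realType) (d : nat) : set 'rV[T]_d :=
  [set x | \sum_i x 0 i ^+ 2 <= 1].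
Definition open_unit_ball (T : realType) (d : nat) : set 'rV[T]_d :=
  [set x | \sum_i x 0 i ^+ 2 < 1].

Definition homeomorphism_on (X Y : topologicalType) (A : set X) (B : set Y)
    (f : X -> Y) : Prop :=
  f @` A = B /\
  exists g : Y -> X, [/\ {within A, continuous f}, {within B, continuous g}
                       & forall x, A x -> g (f x) = x].

(* A finite regular CW complex, as a finite family of disjoint open cells in a
   Hausdorff space: every closed cell is a closed ball, whose boundary sphere is
   a union of closed cells of smaller dimension. The underlying space of the
   complex is the union of the cells, with the topology induced by [cw_space];
   as closed cells are compact, their closures in the two spaces agree. The
   empty face is not a face, and the empty complex is allowed. *)
Record regular_cw (T : realType) := RegularCW {
  cw_space : topologicalType;
  cw_face : finType;
  cw_dim : cw_face -> nat;
  cw_cell : cw_face -> set cw_space;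
  cw_hausdorff : hausdorff_space cw_space;
  cw_disjoint : forall P Q, P <> Q -> cw_cell P `&` cw_cell Q = set0;
  cw_charact : forall P, exists f : 'rV[T]_(cw_dim P) -> cw_space,
    homeomorphism_on (@closed_unit_ball T (cw_dim P)) (closure (cw_cell P)) f /\
    f @` @open_unit_ball T (cw_dim P) = cw_cell P;
  cw_boundary : forall P, exists2 S : {set cw_face},
    (forall Q, Q \in S -> (cw_dim Q < cw_dim P)%N) &
    closure (cw_cell P) `\` cw_cell P =
      \bigcup_(Q in [set Q | Q \in S]) closure (cw_cell Q) }.

Section Faces.
Variables (T : realType) (C : regular_cw T).

Definition is_face (Q P : cw_face C) : bool :=
  `[< cw_cell Q `<=` closure (cw_cell P) >].

Definition is_facet (Q P : cw_face C) : bool :=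
  is_face Q P && ((cw_dim Q).+1 == cw_dim P).

Lemma is_face_trans P Q R : is_face P Q -> is_face Q R -> is_face P R.
Proof.
move=> /asboolP PQ /asboolP QR; apply/asboolP => x /PQ /(closureS QR).
by rewrite -((closure_id _).1 (@closed_closure _ (cw_cell R))).
Qed.

Definition vertex : finType := {v : cw_face C | cw_dim v == 0%N}.

(* [eps Q P] is the incidence number of the facet [Q] of [P]; the edge axiom is
   the codimension two one for the empty face, with [eps empty v = 1]. *)
Record incidence_function (eps : cw_face C -> cw_face C -> int) : Prop := {
  incidence_facet : forall Q P, `|eps Q P|%N = is_facet Q P;
  incidence_edge : forall P, cw_dim P = 1%N -> \sum_Q eps Q P = 0;
  incidence_codim2 : forall S P, \sum_Q eps S Q * eps Q P = 0 }.

Section Induced.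
Variable X : pred vertex.

Definition induced_face : finType :=
  {P : cw_face C | [forall v : vertex, is_face (val v) P ==> X v]}.

Lemma induced_faceS Q P : is_face Q P ->
  [forall v : vertex, is_face (val v) P ==> X v] ->
  [forall v : vertex, is_face (val v) Q ==> X v].
Proof.
move=> QP /forallP XP; apply/forallP => v; apply/implyP => vQ.
exact: (implyP (XP v)) (is_face_trans vQ QP).
Qed.

Lemma induced_disjoint (P Q : induced_face) : P <> Q ->
  cw_cell (val P) `&` cw_cell (val Q) = set0.
Proof. by move=> PQ; apply: cw_disjoint => /val_inj. Qed.

Lemma induced_boundary (P : induced_face) : exists2 S : {set induced_face},
    (forall Q, Q \in S -> (cw_dim (val Q) < cw_dim (val P))%N) &
    closure (cw_cell (val P)) `\` cw_cell (val P) =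
      \bigcup_(Q in [set Q | Q \in S]) closure (cw_cell (val Q)).
Proof.
have [S Sdim SE] := cw_boundary (val P).
exists [set Q : induced_face | val Q \in S]%SET => [Q|].
  by rewrite inE => /Sdim.
rewrite SE; apply/seteqP; split=> x [Q /= QS Qx]; last first.
  by exists (val Q) => //=; move: QS; rewrite inE.
suff QP : is_face Q (val P).
  by exists (Sub Q (induced_faceS QP (valP P))); rewrite /= ?inE ?SubK.
apply/asboolP => y Qy.
have : (\bigcup_(Q in [set Q | Q \in S]) closure (cw_cell Q)) y.
  by exists Q => //=; exact: subset_closure.
by rewrite -SE => -[].
Qed.

Definition induced_cw : regular_cw T := {|
  cw_space := cw_space C;
  cw_face := induced_face;
  cw_dim P := cw_dim (val P);
  cw_cell P := cw_cell (val P);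
  cw_hausdorff := @cw_hausdorff T C;
  cw_disjoint := induced_disjoint;
  cw_charact P := cw_charact (val P);
  cw_boundary := induced_boundary |}.

End Induced.
End Faces.

Arguments vertex {T} C.

Lemma induced_incidence (T : realType) (C : regular_cw T) (X : pred (vertex C))
    (eps : cw_face C -> cw_face C -> int) : incidence_function eps ->
  @incidence_function T (induced_cw X) (fun Q P => eps (val Q) (val P)).
Proof.
move=> [epsF epsE eps2].
have sub_sum (F : cw_face C -> int) (P : induced_face X) :
    (forall Q, eps Q (val P) = 0 -> F Q = 0) ->
    \sum_(Q : induced_face X) F (val Q) = \sum_Q F Q.
  move=> F0; pose b Q := [forall v : vertex C, is_face (val v) Q ==> X v].
  pose ins Q : option (induced_face X) := insub Q.
  rewrite [RHS](bigID b) /= [in RHS](reindex_omap val ins); last first.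
    by move=> Q bQ; rewrite /ins insubT.
  rewrite [in RHS](eq_bigl xpredT); last first.
    by move=> Q; rewrite /ins valK eqxx andbT; exact: (valP Q).
  rewrite [X in _ + X]big1 ?addr0// => Q /negP NXQ; apply: F0.
  apply/eqP; rewrite -absz_eq0 epsF eqb0; apply/negP => /andP[QP _].
  exact: NXQ (induced_faceS QP (valP P)).
split=> [Q P|P dP|S P]; first exact: epsF.
- by rewrite (sub_sum (fun Q => eps Q (val P)) P) //; exact: epsE.
- rewrite (sub_sum (fun Q => eps (val S) Q * eps Q (val P)) P) ?eps2//.
  by move=> Q ->; rewrite mulr0.
Qed.

Definition induced_vertex (T : realType) (C : regular_cw T) (X : pred (vertex C))
    (v : vertex (induced_cw X)) : vertex C := Sub (val (val v)) (valP v).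

End CWComplex.

Import reals mpoly CWComplex.

Section MonomialIdeals.
Variables (k : fieldType) (n : nat).
Local Notation R := {mpoly k[n]}.
Implicit Types (I : R -> Prop) (S : 'X_{1..n} -> Prop).

Definition ideal_span (S : R -> Prop) (p : R) : Prop :=
  exists2 s : seq (R * R), (forall cg, cg \in s -> S cg.2) &
    p = \sum_(cg <- s) cg.1 * cg.2.

Definition monomial_generators S I : Prop :=
  forall p, I p <-> ideal_span (fun q => exists2 m, S m & q = 'X_[m]) p.

Definition monomial_ideal I : Prop := exists S, monomial_generators S I.

Definition minimal_monomial_generators S I : Prop :=
  monomial_generators S I /\
  forall S', (forall m, S' m -> S m) -> monomial_generators S' I ->
    forall m, S m -> S' m.

(* The set G(I), for a monomial ideal I. *)
Definition mingens I (m : 'X_{1..n}) : Prop :=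
  exists2 S, minimal_monomial_generators S I & S m.

(* The zero ideal has no initial degree. *)
Definition initial_degree I (d : nat) : Prop :=
  (exists p, [/\ I p, p != 0 & p \is d.-homog]) /\
  (forall e p, I p -> p != 0 -> p \is e.-homog -> (d <= e)%N).

End MonomialIdeals.

Section GradedComplexes.
Variables (k : fieldType) (n : nat).
Local Notation R := {mpoly k[n]}.

(* The data of a sequence ... -> F_1 -> F_0 -> R of graded free modules of finite
   rank: [gdeg i a] is the degree of the a-th basis element of F_i, and maps act
   on row vectors, so that row [a] of [gdiff i] (of [gaug]) is the image of the
   a-th basis element of F_(i+1) (of F_0). *)
Record graded_seq := GradedSeq {
  grank : nat -> nat;
  gdeg : forall i, 'I_(grank i) -> nat;
  gdiff : forall i, 'M[R]_(grank i.+1, grank i);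
  gaug : 'cV[R]_(grank 0) }.

(* The matrix of a homomorphism of degree 0 between graded free modules whose
   basis elements have degrees [da] and [db]. *)
Definition homog_mx (p q : nat) (da : 'I_p -> nat) (db : 'I_q -> nat)
    (A : 'M[R]_(p, q)) : Prop :=
  forall a b, A a b = 0 \/ exists2 e, da a = (e + db b)%N & A a b \is e.-homog.

Record minimal_free_resolution (I : R -> Prop) (F : graded_seq) : Prop := {
  mfr_diff_homog :
    forall i, homog_mx (@gdeg F i.+1) (@gdeg F i) (gdiff F i);
  mfr_aug_homog : homog_mx (@gdeg F 0) (fun=> 0%N) (gaug F);
  mfr_image : forall p,
    I p <-> exists v : 'rV_(grank F 0), p = (v *m gaug F) 0 0;
  mfr_exact0 : forall v : 'rV_(grank F 0),
    v *m gaug F = 0 <-> exists w, v = w *m gdiff F 0;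
  mfr_exact : forall i (v : 'rV_(grank F i.+1)),
    v *m gdiff F i = 0 <-> exists w, v = w *m gdiff F i.+1;
  mfr_minimal : forall i a b, (gdiff F i a b)@_0%MM = 0 }.

(* In homological degree [i], the summand generated in degree [d + i]. *)
Definition linear_strand (d : nat) (F : graded_seq) : graded_seq :=
  let gens i := [set a | @gdeg F i a == d + i]%N in
  {| grank i := #|gens i|;
     gdeg i a := gdeg (enum_val a);
     gdiff i := mxsub enum_val enum_val (gdiff F i);
     gaug := rowsub enum_val (gaug F) |}.

(* Isomorphisms of degree 0, compatible with the augmentations. *)
Definition graded_iso (C D : graded_seq) : Prop :=
  exists (u : forall i, 'M[R]_(grank C i, grank D i))
         (v : forall i, 'M[R]_(grank D i, grank C i)),
    [/\ forall i, homog_mx (@gdeg C i) (@gdeg D i) (u i),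
        forall i, u i *m v i = 1%:M /\ v i *m u i = 1%:M,
        forall i, gdiff C i *m u i = u i.+1 *m gdiff D i
      & u 0%N *m gaug D = gaug C].

Definition has_linear_resolution (J : R -> Prop) : Prop :=
  exists d F, minimal_free_resolution J F /\
    forall i a, @gdeg F i a = (d + i)%N.

End GradedComplexes.

Section LabelledComplexes.

Record labelled_cw (T : realType) (n : nat) := LabelledCW {
  lcw :> regular_cw T;
  lcw_eps : cw_face lcw -> cw_face lcw -> int;
  lcw_label : vertex lcw -> 'X_{1..n};
  lcw_incidence : incidence_function lcw_eps }.

Definition multidegree (T : realType) (n : nat) (C : labelled_cw T n)
    (P : cw_face C) : 'X_{1..n} :=
  \big[@mlcm n/0%MM]_(v : vertex C | is_face (val v) P) lcw_label v.

Definition induced (T : realType) (n : nat) (C : labelled_cw T n)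
    (X : pred (vertex C)) : labelled_cw T n := {|
  lcw := induced_cw X;
  lcw_eps Q P := lcw_eps (val Q) (val P);
  lcw_label v := lcw_label (induced_vertex v);
  lcw_incidence := induced_incidence X (lcw_incidence C) |}.

(* The vertices whose label satisfies [S]. *)
Definition label_in (T : realType) (n : nat) (C : labelled_cw T n)
    (S : 'X_{1..n} -> Prop) : pred (vertex C) :=
  fun v => boolp.asbool (S (lcw_label v)).

(* The complex with basis the faces of [C], augmented by sending the basis
   element of a vertex to its label. *)
Definition cellular_complex (k : fieldType) (T : realType) (n : nat)
    (C : labelled_cw T n) : graded_seq k n :=
  let faces i := [set P : cw_face C | cw_dim P == i] in
  {| grank i := #|faces i|;
     gdeg i a := mdeg (multidegree (enum_val a));
     gdiff i := \matrix_(a < #|faces i.+1|, b < #|faces i|)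
       let P := enum_val a in let Q := enum_val b in
       'X_[(multidegree P - multidegree Q)%MM] *~ lcw_eps Q P;
     gaug := \col_(a < #|faces 0%N|) 'X_[multidegree (enum_val a)] |}.

(* The augmentations make the vertices correspond to generators: a vertex is sent
   to the generator labelling it. *)
Definition supports (k : fieldType) (T : realType) (n : nat)
    (C : labelled_cw T n) (F : graded_seq k n) : Prop :=
  graded_iso (cellular_complex k C) F.

Definition has_cw_resolution (T : realType) (k : fieldType) (n : nat)
    (J : {mpoly k[n]} -> Prop) : Prop :=
  exists F, minimal_free_resolution J F /\
    exists C : labelled_cw T n, supports C F.

End LabelledComplexes.

(* Main.v *)
Require Import Defs.
From HB Require Import structures.
From mathcomp Require Import all_boot all_order all_algebra.
From mathcomp Require boolp classical_sets cardinality reals topology normedtype.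
From mathcomp Require realfun mpoly.
Import Defs.CWComplex.

(* The linear strand of an ideal with no element of degree less than [d] is, up to
   isomorphism, the only complex [C] of free modules, with [C_i] generated in degree
   [d + i], whose augmentation maps the constant vectors of [C_0] bijectively onto
   the forms of degree [d] of the ideal, and whose differential maps the constant
   vectors of [C_(i+1)] bijectively onto the cycles with linear entries of [C_i].
   So it is enough to prove this property for the complex of the induced
   subcomplex, knowing it for [P], that is: if the boundary of a constant
   combination of (i+1)-faces is supported on induced faces, then so is the
   combination. This holds if distinct faces of the same multidegree have no
   common facet, since no facet of a face of the combination then cancels.

   In fact, distinct faces of the same dimension and multidegree have no common
   vertex. By induction on the dimension, starting with the hypothesis on edges,
   the link of every face at a vertex [v] is a simplex: a face containing [v] is
   determined by its multidegree, a squarefree multiple of that of [v]. Two faces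
   of the same multidegree that share a vertex then share every facet through it.
   As a sphere of positive dimension is connected, they share all their facets; the
   codimension two condition then gives their boundaries the same signs, up to a
   global one, so that the faces are equal by injectivity of the differential. *)

Set Implicit Arguments.
Unset Strict Implicit.
Unset Printing Implicit Defensive.

Local Open Scope ring_scope.

(** * Connectedness of the boundary of a cell *)

Module CellTopology.
Import Order.TTheory GRing.Theory Num.Theory.
Import boolp classical_sets cardinality reals topology normedtype realfun.
Import numFieldTopology.Exports numFieldNormedType.Exports.
Local Open Scope classical_set_scope.

(** * Connectedness of spheres of positive dimension *)

Section Sphere.
Variables (T : realType) (d : nat).
Implicit Types a b c x y : 'rV[T]_d.

Definition dot x y : T := \sum_i x 0 i * y 0 i.

Lemma dotC x y : dot x y = dot y x.
Proof. by apply: eq_bigr => i _; rewrite mulrC. Qed.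

Lemma dotDr x y z : dot x (y + z) = dot x y + dot x z.
Proof. by rewrite -big_split; apply: eq_bigr => i _; rewrite mxE mulrDr. Qed.

Lemma dotZr x t y : dot x (t *: y) = t * dot x y.
Proof. by rewrite mulr_sumr; apply: eq_bigr => i _; rewrite mxE mulrCA. Qed.

Lemma dot_ge0 x : 0 <= dot x x.
Proof. by apply: sumr_ge0 => i _; rewrite -expr2 sqr_ge0. Qed.

Lemma dot_eq0 x : dot x x = 0 -> x = 0.
Proof.
move=> /eqP; rewrite psumr_eq0 => [/allP x0|i _]; last by rewrite -expr2 sqr_ge0.
apply/rowP => i; rewrite mxE; apply/eqP.
by have := x0 i (mem_index_enum _); rewrite mulf_eq0 orbb.
Qed.

Definition unit_sphere : set 'rV[T]_d := [set x | dot x x = 1].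

Lemma dot_normalize a x : x != 0 -> dot a x = 0 ->
  exists c, [/\ dot a c = 0, dot c c = 1 & x = Num.sqrt (dot x x) *: c].
Proof.
move=> x0 ax.
have s0 : Num.sqrt (dot x x) != 0.
  rewrite sqrtr_eq0 -ltNge lt_def dot_ge0 andbT.
  by apply: contraNneq x0 => /dot_eq0 ->.
exists ((Num.sqrt (dot x x))^-1 *: x); split.
- by rewrite dotZr ax mulr0.
- rewrite dotZr dotC dotZr mulrA -invfM -expr2 sqr_sqrtr ?dot_ge0//.
  by rewrite mulVf//; apply: contraNneq x0 => /dot_eq0 ->.
- by rewrite scalerA divff// scale1r.
Qed.

Lemma orthogonal_neq0 a : (1 < d)%N -> exists2 x, x != 0 & dot a x = 0.
Proof.
move=> d1.
have : kermx a^T != 0.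
  rewrite -mxrank_eq0 mxrank_ker -lt0n subn_gt0.
  exact: leq_ltn_trans (rank_leq_col _) d1.
move=> /rowV0Pn[x /sub_kermxP xa x0]; exists x => //.
move/matrixP: xa => /(_ 0 0); rewrite !mxE => <-.
by rewrite dotC; apply: eq_bigr => i _; rewrite mxE.
Qed.

(* The point [b] lies on the half great circle from [a] to [-a] through [c]. *)
Lemma half_circle a b : (1 < d)%N -> dot a a = 1 -> dot b b = 1 ->
  exists c, [/\ dot a c = 0, dot c c = 1, -1 <= dot a b <= 1 &
    b = dot a b *: a + Num.sqrt (1 - dot a b ^+ 2) *: c].
Proof.
move=> d1 aa bb; set t := dot a b.
pose w := b + (- t) *: a.
have aw : dot a w = 0 by rewrite dotDr dotZr aa mulr1 subrr.
have ww : dot w w = 1 - t ^+ 2.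
  rewrite {2}/w dotDr dotZr [dot w a]dotC aw mulr0 addr0.
  by rewrite dotC /w dotDr dotZr bb [dot b a]dotC -/t mulNr expr2.
have bE : b = t *: a + w by rewrite /w addrCA -scalerDl subrr scale0r addr0.
have t1 : -1 <= t <= 1.
  by rewrite -ler_norml -(@expr_le1 _ 2)// real_normK ?num_real// -subr_ge0 -ww dot_ge0.
have [w0|w0] := eqVneq w 0.
  have [x x0 ax] := orthogonal_neq0 a d1.
  have [c [ac cc _]] := dot_normalize x0 ax.
  exists c; split=> //; rewrite -ww w0 -{2}(scale0r 0) dotZr mul0r.
  by rewrite sqrtr0 scale0r addr0 {1}bE w0 addr0.
have [c [ac cc wE]] := dot_normalize w0 aw.
by exists c; split=> //; rewrite -ww -wE.
Qed.

Lemma half_circle_sphere a c t : dot a a = 1 -> dot c c = 1 -> dot a c = 0 ->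
  -1 <= t <= 1 -> unit_sphere (t *: a + Num.sqrt (1 - t ^+ 2) *: c).
Proof.
move=> aa cc ac t1; rewrite /unit_sphere /= dotDr !dotZr ![dot (_ + _) _]dotC.
rewrite !dotDr !dotZr [dot c a]dotC ac aa cc !mulr0 addr0 add0r !mulr1 -!expr2.
rewrite sqr_sqrtr ?subrKC//.
by rewrite subr_ge0 -(real_normK (num_real _)) expr_le1// ler_norml.
Qed.

(** The sphere is the union of the half great circles from a point [a] to [-a]. Each is a continuous
    image of the segment from -1 to 1, the parameter being the scalar product with [a], and all of
    them contain [a]. *)
Lemma unit_sphere_connected : (1 < d)%N -> connected unit_sphere.
Proof.
move=> d1; have [[a aa]|S0] := pselect (exists a, unit_sphere a); last first.
  suff -> : unit_sphere = set0 by exact: connected0.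
  by apply/seteqP; split=> // a aS; apply: S0; exists a.
pose p c (t : T) : 'rV[T]_d := t *: a + Num.sqrt (1 - t ^+ 2) *: c.
pose P := [set c | dot a c = 0 /\ dot c c = 1].
suff -> : unit_sphere = \bigcup_(c in P) (p c @` `[-1, 1]).
  apply: bigcup_connected => [|c _].
    exists a => c _; exists 1.
      by rewrite /= in_itv /= lexx andbT (le_trans _ ler01)// oppr_le0.
    by rewrite /p expr1n subrr sqrtr0 scale0r addr0 scale1r.
  apply: connected_continuous_connected; first exact: segment_connected.
  apply: continuous_subspaceT => t.
  apply: cvgD; first by apply: cvgZr_tmp; exact: cvg_id.
  apply: cvgZr_tmp.
  apply: (@continuous_comp _ _ _ (fun t : T => 1 - t ^+ 2) (@Num.sqrt T));
    last exact: sqrt_continuous.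
  by apply: cvgB; [exact: cvg_cst|exact: exprn_continuous].
apply/seteqP; split=> [b bb|_ [c [ac cc] [t t1 <-]]].
  have [c [ac cc t1 bE]] := half_circle d1 aa bb.
  by exists c; [split|exists (dot a b); [rewrite /= in_itv|rewrite /p -bE]].
by apply: half_circle_sphere => //; move: t1; rewrite /= in_itv.
Qed.

End Sphere.

(** * Closed cells, their faces and their boundaries *)

Section Cells.
Variables (T : realType) (C : regular_cw T).
Implicit Types P Q R : cw_face C.

Lemma cell_neq0 P : cw_cell P !=set0.
Proof.
have [f [_ <-]] := cw_charact P; exists (f 0); exists 0 => //=.
by rewrite /open_unit_ball /= big1 ?ltr01// => i _; rewrite mxE expr0n.
Qed.

Lemma cell_inj P Q x : cw_cell P x -> cw_cell Q x -> P = Q.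
Proof.
move=> Px Qx; apply: contrapT => /cw_disjoint PQ.
by have : (cw_cell P `&` cw_cell Q) x by []; rewrite PQ.
Qed.

Lemma is_face_refl P : is_face P P.
Proof. by apply/asboolP; exact: subset_closure. Qed.

(** By induction on the dimension, since the boundary of a cell is a union of closed cells of
    smaller dimension: a closed cell is the union of the open cells of its faces. *)
Lemma closure_cellP P x : closure (cw_cell P) x ->
  exists2 R, is_face R P & cw_cell R x.
Proof.
have [k] := ubnP (cw_dim P); elim: k => // k IH in P x *; rewrite ltnS => Pk Px.
have [xP|xNP] := pselect (cw_cell P x); first by exists P; rewrite ?is_face_refl.
have [S Sdim SE] := cw_boundary P.
have : (closure (cw_cell P) `\` cw_cell P) x by [].
rewrite SE => -[Q /= QS Qx].
have [R RQ Rx] := IH Q x (leq_trans (Sdim _ QS) Pk) Qx.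
exists R => //; apply: is_face_trans RQ _; apply/asboolP => y Qy.
have : (\bigcup_(Q in [set Q | Q \in S]) closure (cw_cell Q)) y.
  by exists Q => //=; exact: subset_closure.
by rewrite -SE => -[].
Qed.

Lemma is_face_dim Q P : is_face Q P -> Q = P \/ (cw_dim Q < cw_dim P)%N.
Proof.
have [k] := ubnP (cw_dim P); elim: k => // k IH in P Q *; rewrite ltnS => Pk QP.
have [x Qx] := cell_neq0 Q; have Px := asboolW QP _ Qx.
have [xP|xNP] := pselect (cw_cell P x); first by left; apply: cell_inj xP.
right; have [S Sdim SE] := cw_boundary P.
have : (closure (cw_cell P) `\` cw_cell P) x by [].
rewrite SE => -[Q1 /= QS /closure_cellP[R RQ /(cell_inj Qx) RE]].
have lt1 := Sdim _ QS; rewrite -RE in RQ.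
by have [->//|/ltn_trans->//] := IH _ _ (leq_trans lt1 Pk) RQ.
Qed.

(** The characteristic map is injective on the closed ball, so it maps the unit sphere onto the
    boundary of the cell. *)
Lemma boundary_connected P : (1 < cw_dim P)%N ->
  connected (closure (cw_cell P) `\` cw_cell P).
Proof.
move=> P1; have [f [[fB [g [fc gc gf]]] fO]] := cw_charact P.
have dotE (y : 'rV[T]_(cw_dim P)) : dot y y = \sum_i y 0 i ^+ 2.
  by apply: eq_bigr => i _; rewrite expr2.
have SB : @unit_sphere T (cw_dim P) `<=` @closed_unit_ball T (cw_dim P).
  by move=> y; rewrite /unit_sphere /closed_unit_ball /= dotE => ->.
have -> : closure (cw_cell P) `\` cw_cell P = f @` @unit_sphere T (cw_dim P).
  rewrite -fB -fO; apply/seteqP; split=> [_ [[y yB <-] yO]|_ [y yS <-]].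
    exists y => //; rewrite /unit_sphere /= dotE; apply/eqP.
    rewrite eq_le yB leNgt; apply/negP => y1; apply: yO; by exists y.
  split=> [|[z zO /(congr1 g)]]; first by exists y => //; exact: SB.
  rewrite !gf; [move=> zy|exact: SB|exact: ltW].
  by move: zO; rewrite zy /open_unit_ball /= -dotE yS ltxx.
apply: connected_continuous_connected; first exact: unit_sphere_connected.
exact: continuous_subspaceW fc.
Qed.

Definition proper_face Q P := is_face Q P && (cw_dim Q < cw_dim P)%N.

(** An induction principle expressing that the boundary is connected. The closed faces with [U] and
    those without it have closed unions covering the boundary. A common point would lie in the open
    cell of a common face [R], which the step hypothesis excludes. *)
Lemma proper_faces_connected P (U : cw_face C -> Prop) : (1 < cw_dim P)%N ->
  (exists2 Q, proper_face Q P & U Q) ->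
  (forall Q Q' R, proper_face Q P -> proper_face Q' P -> is_face R Q ->
    is_face R Q' -> U Q -> U Q') ->
  forall Q, proper_face Q P -> U Q.
Proof.
move=> P1 [Q0 Q0P UQ0] Ustep.
pose B := closure (cw_cell P) `\` cw_cell P.
pose A (V : cw_face C -> Prop) : set (cw_space C) :=
  \bigcup_(Q in [set Q | proper_face Q P /\ V Q]) closure (cw_cell Q).
have Acl V : closed (A V).
  by apply: closed_bigcup => [|Q _]; [exact: finite_finset|exact: closed_closure].
have AB V : A V `<=` B.
  move=> x [Q [/andP[QP dQ] VQ] Qx]; split.
    have := closureS (asboolW QP) Qx; rewrite -(closure_id _).1//.
    exact: closed_closure.
  move=> Px; have [R RQ /(cell_inj Px) PR] := closure_cellP Qx.
  rewrite -PR in RQ; have [PQ|lt] := is_face_dim RQ.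
    by rewrite PQ ltnn in dQ.
  by have := ltn_trans dQ lt; rewrite ltnn.
have Bsub x : B x -> exists2 Q, proper_face Q P & cw_cell Q x.
  move=> [Px NPx]; have [R RP Rx] := closure_cellP Px.
  exists R => //; rewrite /proper_face RP.
  by have [RE|//] := is_face_dim RP; rewrite RE in Rx.
have AN x : A U x -> ~ A (fun Q => ~ U Q) x.
  move=> [Q [QP UQ] Qx] [Q' [QP' NUQ'] Qx']; apply: NUQ'.
  have [R RQ Rx] := closure_cellP Qx; have [R' RQ' Rx'] := closure_cellP Qx'.
  by rewrite -(cell_inj Rx Rx') in RQ'; exact: Ustep RQ RQ' UQ.
have ABE : A U = B.
  apply: (boundary_connected P1).
  - by have [x Qx] := cell_neq0 Q0; exists x; exists Q0 => //; exact: subset_closure.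
  - exists (~` A (fun Q => ~ U Q)); first by rewrite openC.
    apply/seteqP; split=> [x Ax|x [/Bsub[Q QP Qx] Nx]].
      by split; [exact: AB Ax|exact: AN].
    exists Q; last exact: subset_closure.
    split=> //; apply: contrapT => NU; apply: Nx; exists Q => //.
    exact: subset_closure.
  - by exists (A U) => //; rewrite setIidr.
move=> Q QP; have [x Qx] := cell_neq0 Q.
have : A U x.
  rewrite ABE; apply: (AB xpredT); exists Q => //; exact: subset_closure.
move=> [Q1 [Q1P UQ1] /closure_cellP[R RQ1 /(cell_inj Qx) E]].
by rewrite -E in RQ1; exact: Ustep Q1P QP RQ1 (is_face_refl Q) UQ1.
Qed.

End Cells.
End CellTopology.

From mathcomp Require Import reals mpoly.
Import CellTopology GRing.Theory.

(** * Faces of a given multidegree *)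

Lemma mlcmA n : associative (@mlcm n).
Proof. by move=> m1 m2 m3; apply/mnmP => i; rewrite /mlcm !mnmE maxnA. Qed.

(** Allows the label of one vertex to be split off the big operator defining [multidegree]. *)
HB.instance Definition _ n := Monoid.isComLaw.Build 'X_{1..n} 0%MM (@mlcm n)
  (@mlcmA n) (@mlcmC n) (@mlc0m n).

Section FaceDegrees.
Variables (T : realType) (n : nat) (C : labelled_cw T n).
Implicit Types P Q R v : cw_face C.
Local Notation m := (@multidegree T n C).
Local Notation eps := (@lcw_eps T n C).
Local Notation dim := (@cw_dim T C).

Lemma multidegree_leP P mu :
  (m P <= mu)%MM <-> forall v : vertex C, is_face (val v) P -> (lcw_label v <= mu)%MM.
Proof.
split=> [Pmu v vP|lemu].
  by apply: lepm_trans Pmu; rewrite /multidegree (bigD1 v) //=; exact: lem_mlcml.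
rewrite /multidegree; elim/big_ind: _ => [|x y xmu ymu|//].
  by apply/mnm_lepP => i; rewrite mnm0E.
by rewrite lem_mlcm xmu.
Qed.

Lemma multidegreeS Q P : is_face Q P -> (m Q <= m P)%MM.
Proof.
move=> QP; apply/multidegree_leP => v vQ.
exact: ((multidegree_leP P _).1 (lepm_refl _) v (is_face_trans vQ QP)).
Qed.

Lemma vertex_faceP v Q : dim Q = 0%N -> is_face v Q -> v = Q.
Proof. by move=> Q0 /is_face_dim[//|]; rewrite Q0. Qed.

Lemma multidegree_vertex (v : vertex C) : m (val v) = lcw_label v.
Proof.
rewrite /multidegree (bigD1 v) ?is_face_refl//= big1 ?mlcm0// => w /andP[wv].
have v0 : dim (val v) = 0%N by apply/eqP/(valP v).
by rewrite (val_inj (vertex_faceP v0 wv)) eqxx.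
Qed.

Lemma facet_face Q P : is_facet Q P -> is_face Q P.
Proof. by case/andP. Qed.

Lemma facet_dim Q P : is_facet Q P -> dim P = (dim Q).+1.
Proof. by case/andP => _ /eqP. Qed.

Lemma eps_neq0 Q P : (eps Q P != 0) = is_facet Q P.
Proof.
by rewrite -absz_eq0 (incidence_facet (lcw_incidence C)) eqb0 negbK.
Qed.

Lemma eps_sqr Q P : is_facet Q P -> eps Q P * eps Q P = 1.
Proof.
move=> QP; have := incidence_facet (lcw_incidence C) Q P; rewrite QP.
by case: (eps Q P) => [[|[|k]]|[|k]].
Qed.

Section LocalStructure.
Variable d : nat.
(** These hypotheses isolate what the local argument uses. Apart from [edgeH], they will come from
    the linear strand: [degH] from its degrees, and the other two because a face without facets, or
    two faces with proportional boundaries, would yield a nonzero constant cycle. *)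
Hypothesis degH : forall Q, mdeg (m Q) = (d + dim Q)%N.
Hypothesis edgeH : forall E E', dim E = 1%N -> dim E' = 1%N -> m E = m E' -> E = E'.
Hypothesis facetH : forall P, (0 < dim P)%N -> exists Q, is_facet Q P.
Hypothesis signH : forall P P' (s : int), (0 < dim P)%N -> m P = m P' ->
  (forall Q, eps Q P' = s * eps Q P) -> P = P'.

Lemma vertex_exists P : exists2 v, dim v = 0%N & is_face v P.
Proof.
move Ek : (dim P) => k; elim: k => [|k IH] in P Ek *.
  by exists P; rewrite ?is_face_refl.
have [|Q QP] := facetH (P := P); first by rewrite Ek.
have [|v v0 vQ] := IH Q; first by have := facet_dim QP; rewrite Ek => -[].
by exists v => //; apply: is_face_trans vQ (facet_face QP).
Qed.

Lemma facet_degree Q P : is_facet Q P -> exists a, m P = (m Q + U_(a))%MM.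
Proof.
move=> QP; have le := multidegreeS (facet_face QP).
have : mdeg (m P - m Q) == 1%N.
  have := congr1 mdeg (submK le); rewrite mdegD !degH (facet_dim QP) addnS.
  by move/eqP; rewrite addnC -addn1 eqn_add2l.
by move/mdeg1P => [a /eqP E]; exists a; rewrite -E addmC submK.
Qed.

(* The link of [v] in [P] is a simplex, with one vertex for each variable of the
   squarefree monomial [m P / m v]. *)
Definition simplicial_at v P := forall a, (m v a < m P a)%N ->
  m P a = (m v a).+1 /\
  exists R, [/\ is_facet R P, is_face v R & m P = (m R + U_(a))%MM].

Definition simplicial P := forall v, dim v = 0%N -> is_face v P -> simplicial_at v P.

Definition separated P := forall P' v, dim P' = dim P -> dim v = 0%N ->
  is_face v P -> is_face v P' -> m P = m P' -> P = P'.

(** As long as the degree exceeds [mu], simpliciality at [v] gives a facet through [v] that loses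
    one variable of the excess. *)
Lemma face_of_degree v P mu :
  (forall Q, is_face Q P -> simplicial Q) -> dim v = 0%N -> is_face v P ->
  (m v <= mu)%MM -> (mu <= m P)%MM ->
  exists R, [/\ is_face R P, is_face v R & m R = mu].
Proof.
move Ek : (dim P) => k; elim: k => [|k IH] in P Ek *; move=> simP v0 vP vmu muP.
- exists P; split=> //; first exact: is_face_refl.
  rewrite (vertex_faceP Ek vP) in vmu.
  by apply/mnmP => a; apply/eqP; rewrite eqn_leq (mnm_lepP vmu) (mnm_lepP muP).
have [<-|neq] := eqVneq (m P) mu; first by exists P; rewrite is_face_refl.
have [a lta] : exists a, (mu a < m P a)%N.
  apply/existsP; apply: contraNT neq; rewrite negb_exists => /forallP ge.
  apply/eqP/mnmP => a; apply/eqP; rewrite eqn_leq (mnm_lepP muP) andbT.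
  by rewrite leqNgt ge.
have lva : (m v a < m P a)%N by apply: leq_ltn_trans lta; apply: (mnm_lepP vmu).
have [_ [R [RP vR mR]]] := simP P (is_face_refl P) v v0 vP a lva.
have RP' := facet_face RP.
have [|||Q [QR vQ mQ]] := IH R _ _ v0 vR vmu.
- by have := facet_dim RP; rewrite Ek => -[].
- by move=> Q QR; apply: simP; apply: is_face_trans QR RP'.
- apply/mnm_lepP => b; have := mnm_lepP muP b; move: lta.
  by rewrite mR !mnmDE !mnm1E eqxx addn1 ltnS; case: eqVneq => [<-|_]; rewrite ?addn0.
by exists Q; split=> //; apply: is_face_trans QR RP'.
Qed.

(** A single nonzero term cannot cancel in the codimension two condition. *)
Lemma codim2_other R' R P : is_facet R' R -> is_facet R P ->
  exists R2, [/\ R2 != R, is_facet R' R2 & is_facet R2 P].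
Proof.
move=> R'R RP.
have /existsP[R2 /and3P[? ? ?]] :
    [exists R2, [&& R2 != R, is_facet R' R2 & is_facet R2 P]].
  apply: contraT; rewrite negb_exists => /forallP none.
  have := incidence_codim2 (lcw_incidence C) R' P.
  rewrite (bigD1 R) //= big1 => [|R2 R2R].
    rewrite addr0 => /eqP; rewrite mulf_eq0 -[_ == 0]negbK eps_neq0 R'R /=.
    by rewrite -[_ == 0]negbK eps_neq0 RP.
  have := none R2; rewrite R2R -!eps_neq0 /= negb_and !negbK.
  by move=> /orP[]/eqP->; rewrite ?mul0r ?mulr0.
by exists R2.
Qed.

(** If [m P] is [m R] times the variable [a], then [R] itself omits [a]. For a variable [b] of
    [m R / m v], take the facet [R'] of [R] omitting [b], then the other facet [R2] of [P] that
    contains [R']. *)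
Lemma simplicial_at_facet v R P : is_facet R P -> dim v = 0%N -> is_face v R ->
  simplicial R -> separated R -> simplicial_at v P.
Proof.
move=> RP v0 vR simR sepR; have [a mP] := facet_degree RP.
(* The conclusion [b != a] says that [a] does not divide [m R / m v]; this makes [m P / m v]
   squarefree. *)
have key b : (m v b < m R b)%N -> [/\ b != a, m R b = (m v b).+1 &
    exists R2, [/\ is_facet R2 P, is_face v R2 & m P = (m R2 + U_(b))%MM]].
  move=> /(simR _ v0 vR)[-> [R' [R'R vR' mR]]].
  have [R2 [R2R R'R2 R2P]] := codim2_other R'R RP.
  have vR2 := is_face_trans vR' (facet_face R'R2).
  have [c mR2] := facet_degree R'R2; have [e mP2] := facet_degree R2P.
  (* Otherwise [R2] and [R] would have the same degree and share [v]. Since both paths from [R'] to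
     [P] add the same two variables, [c] must then be [a], and [e] must be [b]. *)
  have cb : c != b.
    apply: contraNneq R2R => cb; apply/eqP/esym/(sepR R2 v) => //.
      by apply/eq_add_S; rewrite -(facet_dim RP) -(facet_dim R2P).
    by rewrite mR2 cb.
  have E x : ((c == x) + (e == x) = (b == x) + (a == x))%N.
    apply: (@addnI (m R' x)); rewrite !addnA.
    have := congr1 (fun mu : 'X_{1..n} => mu x) mP.
    by rewrite mP2 mR2 mR !mnmDE !mnm1E.
  have ca : c = a.
    by have := E c; rewrite eqxx (eq_sym b) (negPf cb) (eq_sym a); case: (c =P a).
  have ba : b != a by rewrite -ca eq_sym.
  have eb : e = b.
    have := E b; rewrite -ca eqxx (negPf cb).
    by case: eqVneq.
  by split=> //; exists R2; rewrite -eb.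
move=> a' lta'; have [aa'|aa'] := eqVneq a' a.
  subst a'; split; last by exists R.
  rewrite mP mnmDE mnm1E eqxx addn1; congr _.+1; apply/eqP.
  rewrite eqn_leq (mnm_lepP (multidegreeS vR)) andbT leqNgt.
  by apply/negP => /key[]; rewrite eqxx.
have Ea' : m P a' = m R a' by rewrite mP mnmDE mnm1E eq_sym (negPf aa') addn0.
by rewrite Ea' in lta' *; have [_ ? ?] := key _ lta'.
Qed.

(* Any face sharing a vertex [v] with a facet lies in a facet: the facets through
   [v] have faces of all the possible degrees at [v], so they contain it. *)
Lemma proper_face_facet P :
  (forall Q, (dim Q < dim P)%N -> simplicial Q /\ separated Q) ->
  forall Q, proper_face Q P -> exists2 R, is_facet R P & is_face Q R.
Proof.
move=> IH; have [P1|P1] := leqP (dim P) 1.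
  move=> Q /andP[QP ltQ]; exists Q; last exact: is_face_refl.
  rewrite /is_facet QP /=; move: ltQ P1; case: (dim P) => [|[|]]//.
  by case: (dim Q).
apply: proper_faces_connected => //.
  have [|R RP] := facetH (P := P); first exact: ltnW.
  exists R; last by exists R; rewrite ?is_face_refl.
  by rewrite /proper_face facet_face//= (facet_dim RP).
move=> Q Q' S QP Q'P SQ SQ' [R RP QR].
have [v v0 vS] := vertex_exists S.
have ltR : (dim R < dim P)%N by rewrite (facet_dim RP).
have [simR sepR] := IH R ltR.
have vQ := is_face_trans vS SQ; have vQ' := is_face_trans vS SQ'.
have vR := is_face_trans vQ QR.
have simvP := simplicial_at_facet RP v0 vR simR sepR.
have /andP[Q'P' ltQ'] := Q'P.
have leQ' := multidegreeS Q'P'.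
(* As [m Q'] is a proper divisor of [m P], a facet through [v] can omit a variable of the quotient.
   Its degree is still a multiple of [m Q'], so it has a face of degree [m Q'] at [v], which is [Q']
   by separation. *)
have [a lta] : exists a, (m Q' a < m P a)%N.
  apply/existsP; apply: contraTT ltQ'; rewrite negb_exists => /forallP ge.
  rewrite -leqNgt -(leq_add2l d) -!degH !mdegE; apply: leq_sum => a _.
  by rewrite leqNgt ge.
have [_ [R2 [R2P vR2 mR2]]] : _ /\ _ :=
  simvP a (leq_ltn_trans (mnm_lepP (multidegreeS vQ') a) lta).
exists R2 => //.
have ltR2 : (dim R2 < dim P)%N by rewrite (facet_dim R2P).
have [||Q2 [Q2R2 vQ2 mQ2]] := face_of_degree (mu := m Q') _ v0 vR2 (multidegreeS vQ').
- move=> Q2 /is_face_dim[->|ltQ2]; first by case: (IH R2 ltR2).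
  by case: (IH Q2 (ltn_trans ltQ2 ltR2)).
- apply/mnm_lepP => b; have := mnm_lepP leQ' b; move: lta.
  by rewrite mR2 !mnmDE !mnm1E eqxx addn1 ltnS; case: eqVneq => [<-|_]; rewrite ?addn0.
suff <- : Q2 = Q' by [].
apply/esym; have [_ sepQ'] := IH Q' ltQ'; apply: (sepQ' Q2 v) => //.
by apply: (@addnI d); rewrite -!degH mQ2.
Qed.

(** Lying in [P'] spreads over the boundary of [P]: at a vertex shared with a face already in [P'],
    simpliciality of [P'] gives a face of degree [m Q'], and separation identifies it with [Q']. *)
Lemma same_degree_facets P P' v :
  (forall Q, (dim Q < dim P)%N -> simplicial Q /\ separated Q) ->
  simplicial P' -> (1 < dim P)%N ->
  dim P' = dim P -> dim v = 0%N -> is_face v P -> is_face v P' -> m P = m P' ->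
  forall Q, proper_face Q P -> is_face Q P'.
Proof.
move=> IH simP' P1 dimE v0 vP vP' mE.
apply: proper_faces_connected => //.
  by exists v => //; rewrite /proper_face vP v0 ltnW.
move=> Q Q' S QP /andP[Q'P ltQ'] SQ SQ' QP'.
have [w w0 wS] := vertex_exists S.
have wQ' := is_face_trans wS SQ'.
have wP' := is_face_trans (is_face_trans wS SQ) QP'.
have [||R [RP' wR mR]] := face_of_degree (mu := m Q') _ w0 wP' (multidegreeS wQ').
- move=> R /is_face_dim[->//|ltR]; have [] // := IH R.
  by rewrite -dimE.
- by rewrite -mE multidegreeS.
suff -> : Q' = R by [].
have [_ sepQ'] := IH Q' ltQ'; apply: (sepQ' R w) => //.
by apply: (@addnI d); rewrite -!degH mR.
Qed.

(* [R] and [R'] meet in a face of codimension two of [P'] through [w], which lies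
   in no other facet of [P']. *)
Lemma facet_pair_sign P R R' w :
  (forall Q, (dim Q < dim P)%N -> simplicial Q /\ separated Q) ->
  is_facet R P -> is_facet R' P -> R != R' ->
  dim w = 0%N -> is_face w R -> is_face w R' ->
  exists u : int, forall P', m P' = m P -> is_facet R P' -> is_facet R' P' ->
    eps R' P' = u * eps R P'.
Proof.
move=> IH RP R'P RR' w0 wR wR'.
have ltP Q : is_facet Q P -> (dim Q < dim P)%N by move=> /facet_dim ->.
have [simR sepR] := IH R (ltP R RP); have [simR' sepR'] := IH R' (ltP R' R'P).
have [a mPR] := facet_degree RP; have [b mPR'] := facet_degree R'P.
have dimR : dim R' = dim R.
  by apply/eq_add_S; rewrite -(facet_dim RP) -(facet_dim R'P).
have ab : a != b.
  apply: contraNneq RR' => ab; apply/eqP/(sepR R' w) => //.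
  by apply: (@addIm _ U_(a)%MM); rewrite -mPR mPR' ab.
have E x : (m R x + (a == x) = m R' x + (b == x))%N.
  by rewrite -!mnm1E -!mnmDE -mPR mPR'.
have ltb : (m w b < m R b)%N.
  have := E b; rewrite eqxx (negPf ab) addn0 addn1 => ->.
  by rewrite ltnS (mnm_lepP (multidegreeS wR')).
have lta : (m w a < m R' a)%N.
  have := E a; rewrite eqxx (eq_sym b) (negPf ab) addn0 addn1 => <-.
  by rewrite ltnS (mnm_lepP (multidegreeS wR)).
(* Removing [b] from [R], or [a] from [R'], gives faces through [w] of the same degree, which
   therefore coincide. *)
have [_ [S [SR wS mR]]] := simR _ w0 wR _ ltb.
have [_ [S' [SR' wS' mR']]] := simR' _ w0 wR' _ lta.
have SS' : S = S'.
  have ltS : (dim S < dim P)%N.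
    by apply: ltn_trans (ltP R RP); rewrite (facet_dim SR).
  have [_ sepS] := IH S ltS; apply: (sepS S' w) => //.
    by apply/eq_add_S; rewrite -(facet_dim SR) -(facet_dim SR').
  apply: (@addIm _ (U_(a) + U_(b))%MM).
  by rewrite [RHS]addmA -mR' -mPR' mPR mR -addmA (addmC U_(b)%MM).
rewrite -{}SS' in SR' wS' mR'.
(* In the codimension two sum for [S] and [P'] only the terms of [R] and [R'] remain, so their
   relative sign does not depend on [P']. *)
exists (- (eps S R * eps S R')) => P' mP' RP' R'P'.
have := incidence_codim2 (lcw_incidence C) S P'.
rewrite (bigD1 R) //= (bigD1 R') 1?eq_sym//= big1 ?addr0 => [|Q /andP[QR QR']].
  move=> /eqP; rewrite addr_eq0 => /eqP /(congr1 ( *%R (eps S R'))).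
  by rewrite mulrN [X in _ = - X]mulrA eps_sqr// mul1r => E'; rewrite mulNr
    -[LHS]opprK -E' mulrCA mulrA.
(* A third facet [Q] between [S] and [P'] would add [a] or [b] to [m S], and so have the degree of
   [R'] or of [R]; separation excludes both. *)
apply/eqP; rewrite mulf_eq0; apply: contraTT isT; rewrite negb_or !eps_neq0.
move=> /andP[SQ QP'].
have wQ := is_face_trans wS (facet_face SQ).
have [c mQ] := facet_degree SQ; have [e mP'Q] := facet_degree QP'.
have dimQ : dim Q = dim R.
  by rewrite (facet_dim SQ) (facet_dim SR).
have E' x : ((c == x) + (e == x) = (b == x) + (a == x))%N.
  apply: (@addnI (m S x)); rewrite !addnA.
  have := congr1 (fun mu : 'X_{1..n} => mu x) mP'.
  by rewrite mP'Q mPR mQ mR !mnmDE !mnm1E.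
have [ca|ca] := eqVneq c a.
  have : R' = Q by apply: (sepR' Q w); rewrite ?dimQ ?mQ ?mR' ?ca.
  by move/eqP; rewrite eq_sym (negPf QR').
have : R = Q.
  apply: (sepR Q w) => //; rewrite mQ mR; congr (_ + U_(_))%MM.
  have := E' c; rewrite eqxx (eq_sym a) (negPf ca) (eq_sym b).
  by case: (c =P b).
by move/eqP; rewrite eq_sym (negPf QR).
Qed.

Lemma simplicial_separated P : simplicial P /\ separated P.
Proof.
move Ek : (dim P) => k; elim/ltn_ind: k => k IHk in P Ek *.
have IH Q : (dim Q < k)%N -> simplicial Q /\ separated Q.
  by move=> ltQ; exact: IHk ltQ _ erefl.
(* Established for all faces of dimension [k], because separation uses the simpliciality of both [P]
   and [P']. *)
have sim P' : dim P' = k -> simplicial P'.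
  move=> P'k v v0 vP'; have [P'0|P'0] := posnP (dim P').
    by rewrite (vertex_faceP P'0 vP') => a; rewrite ltnn.
  have [||R RP' vR] := proper_face_facet (P := P') _ (Q := v).
  - by move=> Q; rewrite P'k; exact: IH.
  - by rewrite /proper_face vP' v0.
  have [|? ?] := IH R; first by rewrite -P'k (facet_dim RP').
  exact: simplicial_at_facet RP' v0 vR _ _.
split=> [|P' v dimE v0 vP vP' mE]; first exact: sim.
have [P1|P1] := leqP (dim P) 1.
  have [P0|P0] := posnP (dim P).
    by rewrite -(vertex_faceP P0 vP) -(vertex_faceP _ vP') // dimE.
  have {}P1 : dim P = 1%N by apply/eqP; rewrite eqn_leq P1.
  by apply: edgeH; rewrite ?dimE.
have IHP Q : (dim Q < dim P)%N -> simplicial Q /\ separated Q.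
  by rewrite Ek; exact: IH.
have simP' : simplicial P' by apply: sim; rewrite dimE.
have PP' := same_degree_facets IHP simP' P1 dimE v0 vP vP' mE.
have P'P : forall Q, proper_face Q P' -> is_face Q P.
  apply: (@same_degree_facets P' P v); rewrite ?dimE//.
  exact: sim.
have facetE Q : is_facet Q P' = is_facet Q P.
  have proper S : is_facet Q S -> proper_face Q S.
    by move=> QS; rewrite /proper_face facet_face// (facet_dim QS) ltnSn.
  apply/idP/idP => QP; apply/andP; rewrite -(facet_dim QP) dimE; split=> //.
    by apply: P'P; exact: proper.
  by apply: PP'; exact: proper.
have [|R0 R0P] := facetH (P := P); first exact: ltnW.
(* The quotient of the two signs at one facet, written as a product since signs are their own
   inverses. *)
pose s := eps R0 P' * eps R0 P.
apply: (signH (s := s)) => //; first exact: ltnW.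
(* Quantifying over all facets above [Q] lets the sign propagate through proper faces of any
   dimension. Two facets meeting at a vertex are compared by [facet_pair_sign], with the same [u]
   for [P] and [P']. *)
pose U Q := forall R, is_facet R P -> is_face Q R -> eps R P' = s * eps R P.
suff allU Q : proper_face Q P -> U Q.
  move=> Q; have [QP|NQP] := boolP (is_facet Q P).
    apply: (allU Q) => //; last exact: is_face_refl.
    by rewrite /proper_face facet_face// (facet_dim QP) ltnSn.
  have z Q' : ~~ is_facet Q Q' -> eps Q Q' = 0.
    by rewrite -eps_neq0 negbK => /eqP.
  by rewrite !z ?mulr0 ?facetE.
apply: proper_faces_connected => //.
  exists R0; first by rewrite /proper_face facet_face// (facet_dim R0P) ltnSn.
  move=> R RP /is_face_dim[<-|]; first by rewrite /s -mulrA eps_sqr ?mulr1.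
  by rewrite -ltnS -(facet_dim R0P) -(facet_dim RP) ltnn.
move=> {}Q Q' S QP Q'P SQ SQ' UQ R' R'P Q'R'.
have [w w0 wS] := vertex_exists S.
have [R RP QR] := proper_face_facet IHP QP.
have [<-|RR'] := eqVneq R R'; first exact: UQ.
have [||u uE] := facet_pair_sign IHP RP R'P RR' w0 _ _.
- exact: is_face_trans wS (is_face_trans SQ QR).
- exact: is_face_trans wS (is_face_trans SQ' Q'R').
rewrite (uE P') ?facetE// (uE P)// (UQ R RP QR).
by rewrite mulrCA.
Qed.

Lemma vertex_in_facet v P : (0 < dim P)%N -> dim v = 0%N -> is_face v P ->
  exists2 R, is_facet R P & is_face v R.
Proof.
move=> P0 v0 vP; apply: (proper_face_facet (P := P)); last first.
  by rewrite /proper_face vP v0.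
by move=> Q _; exact: simplicial_separated.
Qed.

Lemma facet_degree_inj Q P P' : is_facet Q P -> is_facet Q P' -> m P = m P' -> P = P'.
Proof.
move=> QP QP'; have [v v0 vQ] := vertex_exists Q.
have [_ sepP] := simplicial_separated P.
apply: (sepP P' v) => //; first by rewrite (facet_dim QP) (facet_dim QP').
- exact: is_face_trans vQ (facet_face QP).
- exact: is_face_trans vQ (facet_face QP').
Qed.

End LocalStructure.
End FaceDegrees.

(** * Monomial ideals *)

(** The nonconstant terms of [p] only produce monomials of degree greater than [e]. *)
Lemma mcoeffM_homog (k : fieldType) (n : nat) (p q : {mpoly k[n]}) (e : nat)
    (m : 'X_{1..n}) :
  q \is e.-homog -> (mdeg m <= e)%N -> (p * q)@_m = p@_0%MM * q@_m.
Proof.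
move=> qe me; rewrite {1 2}[q]mpolyE mulr_sumr !raddf_sum /= mulr_sumr.
rewrite [LHS]big_seq [RHS]big_seq; apply: eq_bigr => m' m'q.
rewrite -scalerAr !mcoeffZ mulrCA; congr (_ * _); rewrite mcoeffX.
have [<-|ne] := eqVneq m' m; first by have := mcoeffMX p m' 0; rewrite addm0 mulr1 => ->.
rewrite mulr0; apply/eqP; rewrite mcoeff_eq0 (perm_mem (msuppMX p m')).
apply: contra ne => /mapP[m1 _ mE].
suff m10 : m1 = 0%MM by rewrite mE m10 addm0.
apply/eqP; rewrite -mdeg_eq0 -leqn0 -(leq_add2l (mdeg m')) -mdegD -mE addn0.
by rewrite (dhomog_mf qe m'q).
Qed.

Section MonomialIdealTheory.
Variables (k : fieldType) (n : nat).
Local Notation R := {mpoly k[n]}.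
Implicit Types (S : 'X_{1..n} -> Prop) (J : R -> Prop).

Lemma ideal_span_sum (X : R -> Prop) (I : eqType) (s : seq I) (F : I -> R) :
  (forall i, i \in s -> ideal_span X (F i)) -> ideal_span X (\sum_(i <- s) F i).
Proof.
elim: s => [|i s IH] XF.
  by exists [::] => //; rewrite !big_nil.
have [|t tX tE] := IH; first by move=> j js; apply: XF; rewrite inE js orbT.
have [|t' t'X t'E] := XF i; first by rewrite inE eqxx.
exists (t' ++ t); last by rewrite big_cat /= big_cons -t'E -tE.
by move=> cg; rewrite mem_cat => /orP[/t'X|/tX].
Qed.

Lemma monomial_generatorsP S J : monomial_generators S J ->
  forall p, J p <->
    forall m, m \in msupp p -> exists2 m', S m' & (m' <= m)%MM.
Proof.
move=> SJ p; rewrite SJ; split=> [[s sS ->] m|Sp].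
  elim: s sS => [|[c g] s IH] sS; first by rewrite big_nil msupp0.
  rewrite big_cons => /msuppD_le; rewrite mem_cat => /orP[|/IH]; last first.
    by apply=> cg cgs; apply: sS; rewrite inE cgs orbT.
  have [|m' Sm' /= ->] := sS (c, g); first by rewrite inE eqxx.
  rewrite (perm_mem (msuppMX c m')) => /mapP[m1 _ ->].
  by exists m' => //; exact: lem_addr.
rewrite [p]mpolyE; apply: ideal_span_sum => m /Sp[m' Sm' m'm].
exists [:: (p@_m *: 'X_[m - m'], 'X_[m'])].
  by move=> cg; rewrite inE => /eqP -> /=; exists m'.
by rewrite big_seq1 /= -scalerAl -mpolyXD submK.
Qed.

Lemma monomial_idealP J : monomial_ideal J ->
  forall p, J p <-> forall m, m \in msupp p -> J 'X_[m].
Proof.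
move=> [S SJ] p; split=> [/(monomial_generatorsP SJ) Jp m mp|Jp].
  apply/(monomial_generatorsP SJ) => m1; rewrite msuppX inE => /eqP ->.
  exact: Jp.
apply/(monomial_generatorsP SJ) => m /Jp/(monomial_generatorsP SJ).
by apply; rewrite msuppX inE.
Qed.

Lemma mingens_mem J m : mingens J m -> J 'X_[m].
Proof.
move=> [S [SJ _] Sm]; apply/(monomial_generatorsP SJ) => m1.
by rewrite msuppX inE => /eqP ->; exists m => //; exact: lepm_refl.
Qed.

Lemma monomial_minimal_divisor J m : J 'X_[m] ->
  exists m', [/\ J 'X_[m'], (m' <= m)%MM &
    forall m'', J 'X_[m''] -> (m'' <= m')%MM -> m'' = m'].
Proof.
move Ek : (mdeg m) => e; elim/ltn_ind: e => e IH in m Ek * => Jm.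
have [min|] := boolp.pselect (forall m'', J 'X_[m''] -> (m'' <= m)%MM -> m'' = m).
  by exists m; split=> //; exact: lepm_refl.
move=> /boolp.existsNP[m1] /boolp.not_implyP[Jm1] /boolp.not_implyP[m1m ne].
have lt : (mdeg m1 < e)%N.
  rewrite -Ek -(submK m1m) mdegD -[X in (X < _)%N]add0n ltn_add2r lt0n mdeg_eq0.
  by apply: contra_not_neq ne => E; rewrite -(submK m1m) E add0m.
have [m' [Jm' m'm1 m'min]] := IH _ lt m1 erefl Jm1.
by exists m'; split=> //; exact: lepm_trans m'm1 m1m.
Qed.

Lemma mingens_minimal J m : monomial_ideal J -> J 'X_[m] ->
  (forall m', J 'X_[m'] -> (m' <= m)%MM -> m' = m) -> mingens J m.
Proof.
move=> mJ Jm mmin.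
(* The generating set consists of the monomials of [J] that are minimal for divisibility. *)
exists (fun m => J 'X_[m] /\ forall m', J 'X_[m'] -> (m' <= m)%MM -> m' = m) => //.
split=> [p|S' S'S S'J m1 [Jm1 m1min]].
  split=> [/(monomial_idealP mJ) Jp|[s sS ->]].
    rewrite [p]mpolyE; apply: ideal_span_sum => m1 /Jp.
    move=> /monomial_minimal_divisor[m' [Jm' m'm1 m'min]].
    exists [:: (p@_m1 *: 'X_[m1 - m'], 'X_[m'])].
      by move=> cg; rewrite inE => /eqP -> /=; exists m'.
    by rewrite big_seq1 /= -scalerAl -mpolyXD submK.
  have [S SJ] := mJ; apply/SJ; apply: ideal_span_sum => cg /sS[m' [+ _] ->].
  move=> /SJ[t tS ->]; rewrite mulr_sumr; apply: ideal_span_sum => cg' /tS Scg'.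
  exists [:: (cg.1 * cg'.1, cg'.2)]; first by move=> ?; rewrite inE => /eqP ->.
  by rewrite big_seq1 mulrA.
have /(monomial_generatorsP S'J)/(_ m1) := Jm1.
rewrite msuppX inE eqxx => /(_ isT)[m' S'm' m'm1].
by rewrite -(m1min m') //; have [] := S'S _ S'm'.
Qed.

Lemma mingens_low_degree J d m : monomial_ideal J ->
  (forall e p, J p -> p != 0 -> p \is e.-homog -> (d <= e)%N) ->
  J 'X_[m] -> mdeg m = d -> mingens J m.
Proof.
move=> mJ Jd Jm md; apply: mingens_minimal => // m' Jm' m'm.
have dm' : (d <= mdeg m')%N.
  by apply: (Jd _ _ Jm'); rewrite ?dhomogX// -msupp_eq0 msuppX.
have := submK m'm; suff -> : (m - m')%MM = 0%MM by rewrite add0m.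
apply/eqP; rewrite -mdeg_eq0 -leqn0 -(leq_add2r (mdeg m')) -mdegD submK//.
by rewrite md.
Qed.

End MonomialIdealTheory.

(** * Linear strands *)

Section LinearStrands.
Variables (k : fieldType) (n : nat).
Local Notation R := {mpoly k[n]}.
Implicit Types (C D : graded_seq k n) (J : R -> Prop).

Definition mxhomog (e p q : nat) (A : 'M[R]_(p, q)) : Prop :=
  forall a b, A a b \is e.-homog.

Lemma mxhomogM e f p q r (A : 'M_(p, q)) (B : 'M_(q, r)) :
  mxhomog e A -> mxhomog f B -> mxhomog (e + f) (A *m B).
Proof.
move=> Ae Bf a b; rewrite mxE; apply: rpred_sum => c _.
exact: dhomogM (Ae a c) (Bf c b).
Qed.

Lemma mxhomogN e p q (A : 'M_(p, q)) : mxhomog e A -> mxhomog e (- A).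
Proof. by move=> Ae a b; rewrite mxE rpredN. Qed.

Lemma mxhomogD e p q (A B : 'M_(p, q)) :
  mxhomog e A -> mxhomog e B -> mxhomog e (A + B).
Proof. by move=> Ae Be a b; rewrite mxE rpredD. Qed.

Lemma mxhomog1 p : mxhomog 0 (1%:M : 'M_p).
Proof. by move=> a b; rewrite mxE; case: eqP; rewrite ?mulr1n ?dhomog1// dhomog0. Qed.

Lemma mxhomog_row e p q (A : 'M_(p, q)) a : mxhomog e A -> mxhomog e (row a A).
Proof. by move=> Ae b c; rewrite mxE. Qed.

(** With [bdry], treats the augmentation as the boundary map leaving index 0, whose target is the
    ring, of rank one. *)
Definition bdry_rank C i := if i is j.+1 then grank C j else 1%N.

Definition bdry C i : 'M[R]_(grank C i, bdry_rank C i) :=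
  match i with 0 => gaug C | j.+1 => gdiff C j end.

(* As [C i] is generated in degree [d + i], the matrices with entries in degree
   0 or 1 represent its elements of degree [d + i] and [d + i + 1]. *)
Record is_linear_strand J d C : Prop := {
  ls_deg : forall i a, @gdeg _ _ C i a = (d + i)%N;
  ls_aug : mxhomog d (gaug C);
  ls_diff : forall i, mxhomog 1 (gdiff C i);
  ls_complex : forall i, gdiff C i *m bdry C i = 0;
  ls_image : forall p, p \is d.-homog ->
    J p <-> exists2 c : 'rV_(grank C 0), mxhomog 0 c & p = (c *m gaug C) 0 0;
  ls_inj : forall i (c : 'rV_(grank C i)), mxhomog 0 c -> c *m bdry C i = 0 -> c = 0;
  ls_exact : forall i (w : 'rV_(grank C i)), mxhomog 1 w -> w *m bdry C i = 0 ->
    exists2 c, mxhomog 0 c & w = c *m gdiff C i }.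

Arguments ls_diff {J d C} _ i a b : rename.
Arguments ls_deg {J d C} _ i a : rename.

(** * Uniqueness of linear strands *)

Section Uniqueness.
Variables (J : R -> Prop) (d : nat).

Lemma ls_inj_mx C i p (A : 'M_(p, grank C i)) : is_linear_strand J d C ->
  mxhomog 0 A -> A *m bdry C i = 0 -> A = 0.
Proof.
move=> lsC A0 AC; apply/row_matrixP => a; rewrite row0.
apply: (ls_inj lsC); first exact: mxhomog_row.
by rewrite -row_mul AC row0.
Qed.

Lemma row_choice p q e (P : 'I_p -> 'rV[R]_q -> Prop) :
  (forall a, exists2 c, mxhomog e c & P a c) ->
  exists2 A : 'M_(p, q), mxhomog e A & forall a, P a (row a A).
Proof.
move=> H; have [|f fP] := @boolp.choice _ _ (fun a c => mxhomog e c /\ P a c).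
  by move=> a; have [c] := H a; exists c.
 exists (\matrix_a f a) => a.
  by move=> b; rewrite mxE; have [] := fP a.
by rewrite rowK; have [] := fP a.
Qed.

Lemma ls_exact_mx C i p (A : 'M_(p, grank C i)) : is_linear_strand J d C ->
  mxhomog 1 A -> A *m bdry C i = 0 ->
  exists2 B, mxhomog 0 B & A = B *m gdiff C i.
Proof.
move=> lsC A1 AC.
have [|B B0 AB] := @row_choice p (grank C i.+1) 0 (fun a c => row a A = c *m gdiff C i).
  move=> a; apply: (ls_exact lsC); first exact: mxhomog_row.
  by rewrite -row_mul AC row0.
by exists B => //; apply/row_matrixP => a; rewrite AB row_mul.
Qed.

(** The comparison map is lifted step by step: [u 0] because both augmentations describe the forms
    of degree [d] of [J], then [u i.+1] by exactness, since the rows of [gdiff C i *m u i] are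
    cycles of [D] with linear entries. *)
Lemma ls_morphism C D : is_linear_strand J d C -> is_linear_strand J d D ->
  exists u : forall i, 'M[R]_(grank C i, grank D i),
    [/\ forall i, mxhomog 0 (u i), u 0%N *m gaug D = gaug C
      & forall i, gdiff C i *m u i = u i.+1 *m gdiff D i].
Proof.
move=> lsC lsD.
(* The invariant that makes the next lift possible. *)
pose P i (U : 'M[R]_(grank C i, grank D i)) :=
  mxhomog 0 U /\ gdiff C i *m U *m bdry D i = 0.
have [u0 [u0P u0E]] : exists U, P 0%N U /\ U *m gaug D = gaug C.
  have [|U U0 UE] := @row_choice (grank C 0) (grank D 0) 0
      (fun a c => gaug C a 0 = (c *m gaug D) 0 0).
    move=> a; apply/(ls_image lsD); first exact: ls_aug lsC a 0.
    apply/(ls_image lsC); first exact: ls_aug lsC a 0.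
    exists (row a 1%:M); first exact/mxhomog_row/mxhomog1.
    by rewrite -row_mul mul1mx mxE.
  have E : U *m gaug D = gaug C.
    by apply/matrixP => a b; rewrite (ord1 b) UE -row_mul [RHS]mxE.
  by exists U; split=> //; split=> //; rewrite -mulmxA E (ls_complex lsC 0).
have step i (U : {U | P i U}) :
    {U' : {U' | P i.+1 U'} | gdiff C i *m sval U = sval U' *m gdiff D i}.
  apply: boolp.cid; case: U => U [U0 UP] /=.
  have [|U' U'0 E] := ls_exact_mx lsD _ UP.
    exact: mxhomogM (ls_diff lsC i) U0.
  suff U'P : P i.+1 U' by exists (exist _ U' U'P).
  by split=> //=; rewrite -mulmxA -E mulmxA (ls_complex lsC i.+1) mul0mx.
pose s : forall i, {U | P i U} :=
  nat_rect _ (exist _ u0 u0P) (fun i U => sval (step i U)).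
exists (fun i => sval (s i)); split=> // i; first by have [] := svalP (s i).
exact: svalP (step i (s i)).
Qed.

(** By induction, [u i - 1] is a constant matrix killed by the boundary, hence zero. Both composites
    of the comparison maps are thus identities. *)
Lemma ls_endomorphism C (u : forall i, 'M[R]_(grank C i, grank C i)) :
  is_linear_strand J d C -> (forall i, mxhomog 0 (u i)) ->
  u 0%N *m gaug C = gaug C -> (forall i, gdiff C i *m u i = u i.+1 *m gdiff C i) ->
  forall i, u i = 1%:M.
Proof.
move=> lsC u0 uaug udiff i; apply/eqP; rewrite -subr_eq0; apply/eqP.
apply: (ls_inj_mx lsC); first exact/mxhomogD/mxhomogN/mxhomog1.
elim: i => [|i /(ls_inj_mx lsC) IH]; rewrite mulmxBl mul1mx /=.
  by rewrite uaug subrr.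
have /eqP := IH (mxhomogD (u0 i) (mxhomogN (@mxhomog1 _))).
by rewrite subr_eq0 -udiff => /eqP ->; rewrite mulmx1 subrr.
Qed.

Lemma ls_unique C D : is_linear_strand J d C -> is_linear_strand J d D ->
  graded_iso C D.
Proof.
move=> lsC lsD.
have [u [u0 uaug udiff]] := ls_morphism lsC lsD.
have [v [v0 vaug vdiff]] := ls_morphism lsD lsC.
exists u, v; split=> // i.
  move=> a b; right; exists 0%N; last exact: u0.
  by rewrite (ls_deg lsC) (ls_deg lsD).
split.
  apply: (ls_endomorphism (u := fun i => u i *m v i) lsC) => [j||j].
  - exact: mxhomogM (u0 j) (v0 j).
  - by rewrite -mulmxA vaug.
  - by rewrite mulmxA udiff -mulmxA vdiff mulmxA.
apply: (ls_endomorphism (u := fun i => v i *m u i) lsD) => [j||j].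
- exact: mxhomogM (v0 j) (u0 j).
- by rewrite -mulmxA uaug.
- by rewrite mulmxA vdiff -mulmxA udiff mulmxA.
Qed.

(** Reduction modulo the ideal of the variables, lifted back to constant polynomials. *)
Definition constants p q (A : 'M[R]_(p, q)) : 'M[R]_(p, q) :=
  map_mx (fun x : R => (x@_0%MM)%:MP) A.

Lemma mxhomog0_const p q (A : 'M[R]_(p, q)) :
  mxhomog 0 (constants A).
Proof.
move=> a b; rewrite mxE; apply/dhomogP => m.
rewrite mcoeff_msupp mcoeffC; have [->|_] := eqVneq m 0%MM.
  by move=> _; exact: mdeg0.
by rewrite mulr0 eqxx.
Qed.

Lemma const_mulmx p q r (A : 'M[R]_(p, q)) (B : 'M_(q, r)) :
  constants (A *m B) =
  constants A *m constants B.
Proof.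
apply/matrixP => a b; rewrite !mxE !raddf_sum; apply: eq_bigr => c _.
by rewrite !mxE /= rmorphM /= mpolyCM.
Qed.

Lemma dhomog0_const (p : R) : p \is 0.-homog -> (p@_0%MM)%:MP = p.
Proof.
move=> p0; apply/mpolyP => m.
rewrite mcoeffC; have [->|m0] := eqVneq m 0%MM; first by rewrite mulr1.
by rewrite mulr0 (dhomog_nemf_coeff p0) // mdeg_eq0.
Qed.

Lemma mxhomog0E p q (A : 'M[R]_(p, q)) : mxhomog 0 A -> constants A = A.
Proof. by move=> A0; apply/matrixP => a b; rewrite mxE dhomog0_const. Qed.

(* The inverse of an isomorphism of degree 0 is determined by its constant part,
   since both modules are generated in the same degree. *)
Lemma graded_iso_const C D i (u : 'M[R]_(grank C i, grank D i)) v :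
  (forall a, @gdeg _ _ D i a = (d + i)%N) ->
  homog_mx (@gdeg _ _ C i) (@gdeg _ _ D i) u ->
  u *m v = 1%:M -> v *m u = 1%:M ->
  [/\ forall a, @gdeg _ _ C i a = (d + i)%N, mxhomog 0 u & mxhomog 0 v].
Proof.
move=> degD uhom uv vu.
have uv0 : constants u *m
    constants v = 1%:M.
  by rewrite -const_mulmx uv mxhomog0E//; exact: mxhomog1.
have degC a : @gdeg _ _ C i a = (d + i)%N.
  have [b ub] : exists b, (u a b)@_0%MM != 0.
    apply/existsP; apply: contraT; rewrite negb_exists => /forallP u0.
    move/matrixP: uv0 => /(_ a a); rewrite !mxE eqxx big1 => [/eqP|b _].
      by rewrite eq_sym oner_eq0.
    by have /negPn/eqP := u0 b; rewrite !mxE => ->; rewrite mpolyC0 mul0r.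
  have [u0|[e -> ue]] := uhom a b; first by rewrite u0 mcoeff0 eqxx in ub.
  suff -> : e = 0%N by rewrite degD.
  by rewrite -(dhomog_mf ue (x := 0%MM)) ?mcoeff_msupp//; exact: mdeg0.
have u0 : mxhomog 0 u.
  move=> a b; have [->|[e]] := uhom a b; first exact: dhomog0.
  by rewrite degC degD -[LHS]add0n => /addIn <-.
split=> // a b.
suff -> : v = constants v by exact: mxhomog0_const.
by rewrite -[RHS]mul1mx -vu -mulmxA -(mxhomog0E u0) uv0 mulmx1.
Qed.

Lemma ls_transport C D : graded_iso C D -> is_linear_strand J d D ->
  is_linear_strand J d C.
Proof.
move=> [u [v [uhom uv udiff uaug]]] lsD.
have cst i := graded_iso_const (ls_deg lsD i) (uhom i) (uv i).1 (uv i).2.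
have vu i := (uv i).2; have {}uv i := (uv i).1.
have degC i a : @gdeg _ _ C i a = (d + i)%N by have [-> _ _] := cst i.
have u0 i : mxhomog 0 (u i) by have [_ ui _] := cst i; exact: ui.
have v0 i : mxhomog 0 (v i) by have [_ _ vi] := cst i; exact: vi.
have diffE i : gdiff C i = u i.+1 *m gdiff D i *m v i.
  by rewrite -udiff -mulmxA uv mulmx1.
(* [U i] is the isomorphism between the targets of the boundaries: the identity of the ring when
   [i = 0], and [v] in the previous degree otherwise. *)
have [U [UE U0]] : exists U : forall i, 'M[R]_(bdry_rank D i, bdry_rank C i),
    (forall i, bdry C i = u i *m bdry D i *m U i) /\
    (forall i p (A : 'M_(p, _)), A *m U i = 0 -> A = 0).
  exists (fun i => match i return 'M[R]_(bdry_rank D i, bdry_rank C i) with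
                   0 => (1%:M : 'M[R]_1) | j.+1 => v j end).
  split=> [[|i]|[|i] p A /=].
  - by rewrite /= mulmx1 uaug.
  - exact: diffE.
  - by rewrite mulmx1.
  - by move=> /(congr1 (mulmx^~ (u i))); rewrite -mulmxA vu mulmx1 mul0mx.
have kerE i p (A : 'M_(p, _)) : A *m bdry C i = 0 <-> A *m u i *m bdry D i = 0.
  rewrite UE !mulmxA; split=> [/U0//|->]; exact: mul0mx.
split=> //.
- by rewrite -uaug; exact: mxhomogM (u0 0%N) (ls_aug lsD).
- move=> i; rewrite diffE.
  exact: mxhomogM (mxhomogM (u0 _) (ls_diff lsD i)) (v0 i).
- by move=> i; apply/kerE; rewrite udiff -mulmxA (ls_complex lsD) mulmx0.
- move=> p pd; rewrite (ls_image lsD pd); split=> -[c c0 ->].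
    exists (c *m v 0%N); first exact: mxhomogM c0 (v0 _).
    by rewrite -uaug mulmxA -[_ *m _ *m u _]mulmxA vu mulmx1.
  exists (c *m u 0%N); first exact: mxhomogM c0 (u0 _).
  by rewrite -mulmxA uaug.
- move=> i c c0 /kerE cD.
  have /(congr1 (mulmx^~ (v i))) := ls_inj lsD (mxhomogM c0 (u0 i)) cD.
  by rewrite -mulmxA uv mulmx1 mul0mx.
- move=> i w w1 /kerE wD.
  have [|c c0 cE] := ls_exact lsD _ wD.
    by exact: mxhomogM w1 (u0 i).
  exists (c *m v i.+1); first exact: mxhomogM c0 (v0 _).
  rewrite diffE !mulmxA -[c *m _ *m _]mulmxA vu mulmx1 -cE.
  by rewrite -mulmxA uv mulmx1.
Qed.

End Uniqueness.

(** * Subcomplexes spanned by part of a basis *)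

Section Subsequence.
Variables (C : graded_seq k n) (r : nat -> nat).
Variable iota : forall i, 'I_(r i) -> 'I_(grank C i).

Definition sub_seq : graded_seq k n := {|
  grank := r;
  gdeg i a := gdeg (iota a);
  gdiff i := mxsub (@iota i.+1) (@iota i) (gdiff C i);
  gaug := rowsub (@iota 0) (gaug C) |}.

(** The matrix of the inclusion of the summand; its transpose is the projection onto it. *)
Definition inc i : 'M[R]_(r i, grank C i) := rowsub (@iota i) 1%:M.

Definition supported i p (A : 'M[R]_(p, grank C i)) :=
  forall b, (forall a, iota a <> b) -> forall x, A x b = 0.

Hypothesis iota_inj : forall i, injective (@iota i).
Hypothesis stable : forall i a, supported (row (iota a) (gdiff C i)).

Lemma mxhomog_inc i : mxhomog 0 (inc i).
Proof. by move=> a b; rewrite mxE; exact: mxhomog1. Qed.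

Lemma mxhomog_incT i : mxhomog 0 (inc i)^T.
Proof. by move=> a b; rewrite mxE; exact: mxhomog_inc. Qed.

Lemma inc_mulmx i q (A : 'M_(grank C i, q)) : inc i *m A = rowsub (@iota i) A.
Proof. by rewrite mul_rowsub_mx mul1mx. Qed.

Lemma mulmx_incT i q (A : 'M_(q, grank C i)) : A *m (inc i)^T = colsub (@iota i) A.
Proof. by rewrite /inc trmx_mxsub trmx1 mulmx_colsub mulmx1. Qed.

Lemma incK i : inc i *m (inc i)^T = 1%:M.
Proof.
rewrite inc_mulmx; apply/matrixP => a b; rewrite !mxE.
by rewrite (inj_eq (@iota_inj i)) eq_sym.
Qed.

Lemma mulmx_inc_eq0 i p (A : 'M_(p, r i)) : A *m inc i = 0 -> A = 0.
Proof.
by move=> A0; rewrite -[A]mulmx1 -incK mulmxA A0 mul0mx.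
Qed.

Lemma mulmx_incE i p (A : 'M_(p, r i)) x a : (A *m inc i) x (iota a) = A x a.
Proof. by rewrite -[A in RHS]mulmx1 -incK mulmxA mulmx_incT [RHS]mxE. Qed.

Lemma supportedE i p (A : 'M_(p, _)) : supported A -> A = A *m (inc i)^T *m inc i.
Proof.
move=> supA; apply/matrixP => x b; rewrite mulmx_incT mxE.
have [[a <-]|none] := boolp.pselect (exists a, iota a = b).
  rewrite (bigD1 a)//= big1 => [|c /negPf ca]; rewrite !mxE ?eqxx ?mulr1 ?addr0//.
  by rewrite (inj_eq (@iota_inj i)) ca mulr0.
have Nb a : iota a <> b by move=> ab; apply: none; exists a.
rewrite supA// big1 // => a _; rewrite !mxE.
by have /eqP/negPf -> := Nb a; rewrite mulr0.
Qed.

Lemma supported_inc i p (A : 'M_(p, r i)) : supported (A *m inc i).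
Proof.
move=> b Nb x; rewrite mxE big1 // => a _; rewrite !mxE.
by have /eqP/negPf -> := Nb a; rewrite mulr0.
Qed.

Lemma sub_diff i : inc i.+1 *m gdiff C i = gdiff sub_seq i *m inc i.
Proof.
have E : supported (inc i.+1 *m gdiff C i).
  move=> b Nb x; rewrite inc_mulmx mxE.
  by have := stable x Nb 0; rewrite mxE.
by rewrite (supportedE E) inc_mulmx mulmx_incT; congr (_ *m _);
  apply/matrixP => a b; rewrite !mxE.
Qed.

Lemma sub_kernel i p (A : 'M_(p, r i)) :
  A *m bdry sub_seq i = 0 <-> A *m inc i *m bdry C i = 0.
Proof.
case: i A => [|i] A; first by rewrite -mulmxA inc_mulmx.
rewrite -mulmxA /bdry -/(gdiff C i) sub_diff mulmxA.
by split=> [->|/mulmx_inc_eq0//]; rewrite mul0mx.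
Qed.

Lemma sub_complex : (forall i, gdiff C i *m bdry C i = 0) ->
  forall i, gdiff sub_seq i *m bdry sub_seq i = 0.
Proof.
by move=> CC i; apply/sub_kernel; rewrite -sub_diff -mulmxA CC mulmx0.
Qed.

(** Exactness passes to the subcomplex by the last hypothesis: a linear cycle of the subcomplex
    bounds a constant vector of [C], which is supported because its boundary is. *)
Lemma ls_sub_seq I J d : is_linear_strand I d C ->
  (forall p, p \is d.-homog -> J p <->
    exists2 c : 'rV_(grank C 0), mxhomog 0 c /\ supported c & p = (c *m gaug C) 0 0) ->
  (forall i (c : 'rV_(grank C i.+1)), mxhomog 0 c ->
    supported (c *m gdiff C i) -> supported c) ->
  is_linear_strand J d sub_seq.
Proof.
move=> lsC Jimage suppC; split.
- by move=> i a; exact: ls_deg lsC i _.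
- by move=> a b; rewrite mxE; exact: ls_aug lsC _ _.
- by move=> i a b; rewrite mxE; exact: ls_diff lsC i _ _.
- exact: sub_complex (ls_complex lsC).
- move=> p pd; rewrite Jimage//; split=> [[c [c0 /supportedE cE] ->]|[c c0 ->]].
    exists (c *m (inc 0)^T); first exact: mxhomogM c0 (@mxhomog_incT _).
    by rewrite {1}cE -[in LHS]mulmxA inc_mulmx.
  exists (c *m inc 0); last by rewrite -mulmxA inc_mulmx.
  by split; [exact: mxhomogM c0 (@mxhomog_inc _)|exact: supported_inc].
- move=> i c c0 /sub_kernel/(ls_inj lsC (mxhomogM c0 (@mxhomog_inc _))).
  exact: mulmx_inc_eq0.
- move=> i w w1 /sub_kernel wC.
  have [|c c0 cE] := ls_exact lsC _ wC.
    by exact: mxhomogM w1 (@mxhomog_inc _).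
  have /supportedE cS : supported c.
    by apply: suppC => //; rewrite -cE; exact: supported_inc.
  exists (c *m (inc i.+1)^T); first exact: mxhomogM c0 (@mxhomog_incT _).
  rewrite -[LHS]mulmx1 -incK mulmxA cE {1}cS -[_ *m inc _ *m _]mulmxA sub_diff.
  by rewrite mulmxA -mulmxA incK mulmx1.
Qed.

End Subsequence.
End LinearStrands.

Arguments ls_deg {k n J d C} _ i a : rename.
Arguments ls_diff {k n J d C} _ i a b : rename.

(** * The linear strand of a minimal free resolution *)

Section Resolution.
Variables (k : fieldType) (n : nat) (J : {mpoly k[n]} -> Prop) (d : nat).
Variable G : graded_seq k n.
Local Notation R := {mpoly k[n]}.
Hypothesis resG : minimal_free_resolution J G.

Definition target_degree i : 'I_(bdry_rank G i) -> nat :=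
  match i with 0 => fun=> 0%N | j.+1 => @gdeg _ _ G j end.

Lemma bdry_homog i : homog_mx (@gdeg _ _ G i) (@target_degree i) (bdry G i).
Proof.
by case: i => [|i]; [exact: mfr_aug_homog resG|exact: mfr_diff_homog resG i].
Qed.

Lemma bdry_exact i (v : 'rV_(grank G i)) :
  v *m bdry G i = 0 <-> exists w, v = w *m gdiff G i.
Proof.
by case: i v => [|i] v; [exact: (mfr_exact0 resG)|exact: (mfr_exact resG)].
Qed.

Lemma gdiff_const i p (w : 'M_(p, grank G i.+1)) x b :
  ((w *m gdiff G i) x b)@_0%MM = 0.
Proof.
rewrite mxE raddf_sum big1 //= => a _.
by rewrite rmorphM /= (mfr_minimal resG) mulr0.
Qed.

Lemma gdiff_complex i : gdiff G i *m bdry G i = 0.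
Proof.
apply/row_matrixP => a; rewrite row_mul row0; apply/bdry_exact.
by exists (row a 1%:M); rewrite -row_mul mul1mx.
Qed.

(** A basis element with zero boundary would itself be a boundary, but by minimality the entries of
    a boundary have no constant term. *)
Lemma bdry_row_neq0 i a : exists b, bdry G i a b != 0.
Proof.
apply/existsP; apply: contraT; rewrite negb_exists => /forallP B0.
have /bdry_exact[w wE] : delta_mx 0 a *m bdry G i = 0 :> 'rV_(_).
  by rewrite -rowE; apply/rowP => b; rewrite !mxE; apply/eqP/negPn/B0.
have := gdiff_const w 0 a; rewrite -wE mxE !eqxx mcoeff1 eqxx => /eqP.
by rewrite oner_eq0.
Qed.

Lemma gaug_mem a : J (gaug G a 0).
Proof.
by apply/(mfr_image resG); exists (delta_mx 0 a); rewrite -rowE mxE.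
Qed.

Hypothesis Jlow : forall e p, J p -> p != 0 -> p \is e.-homog -> (d <= e)%N.

(** By minimality, a nonzero entry of a differential has positive degree, so the degrees of
    generators grow by at least one at each step. *)
Lemma gdeg_low i (a : 'I_(grank G i)) : (d + i <= gdeg a)%N.
Proof.
elim: i a => [|i IH] a; have [b nz] := bdry_row_neq0 a; have := bdry_homog a b.
  case=> [E|[e -> Be]]; first by rewrite E eqxx in nz.
  rewrite ord1 in nz Be; rewrite !addn0; exact: Jlow (gaug_mem a) nz Be.
case=> [E|[e -> Be]]; first by rewrite E eqxx in nz.
rewrite addnS -add1n leq_add ?IH// lt0n; apply: contraNneq nz => e0.
rewrite e0 in Be.
by rewrite -[bdry _ _ _ _](dhomog0_const Be) (mfr_minimal resG) mpolyC0.
Qed.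

(** An arbitrary enumeration of the generators of degree [d + i], covering both [linear_strand] and,
    for a linear resolution, the identity. *)
Variables (r : nat -> nat) (iota : forall i, 'I_(r i) -> 'I_(grank G i)).
Hypothesis iota_inj : forall i, injective (@iota i).
Hypothesis iotaP : forall i b, (exists a, @iota i a = b) <-> gdeg b = (d + i)%N.

Lemma gdeg_iota i (a : 'I_(r i)) : gdeg (iota a) = (d + i)%N.
Proof. by apply/iotaP; exists a. Qed.

Lemma gdiff_linear i (a : 'I_(r i.+1)) b : gdiff G i (iota a) b = 0 \/
  gdeg b = (d + i)%N /\ gdiff G i (iota a) b \is 1.-homog.
Proof.
have [->|nz] := eqVneq (gdiff G i (iota a) b) 0; first by left.
have [E|[e degE Be]] := bdry_homog (i := i.+1) (iota a) b.
  by rewrite [gdiff _ _ _ _]E eqxx in nz.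
right; rewrite gdeg_iota /= in degE.
have e0 : e != 0%N.
  apply: contraNneq nz => e0; rewrite e0 in Be.
  by rewrite -(dhomog0_const Be) (mfr_minimal resG) mpolyC0.
have e1 : e = 1%N.
  apply/eqP; rewrite eqn_leq lt0n e0 andbT -(leq_add2r (d + i)) add1n -addnS degE.
  by rewrite leq_add2l gdeg_low.
by move: degE Be; rewrite e1 addnS add1n => -[->].
Qed.

Lemma iota_stable i a : supported iota (row (@iota i.+1 a) (gdiff G i)).
Proof.
move=> b Nb x; rewrite mxE; have [//|[/iotaP[a' ab] _]] := gdiff_linear a b.
by have := Nb a'.
Qed.

(* Only generators of degree [d + i] contribute to the component of degree
   [d + i] of a boundary, and only through constants. *)
Lemma bdry_low_degree i p (w : 'M_(p, grank G i)) x b e m :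
  (d + i = e + target_degree b)%N -> mdeg m = e ->
  ((w *m bdry G i) x b)@_m =
  ((constants (w *m (inc iota i)^T) *m inc iota i *m bdry G i) x b)@_m.
Proof.
move=> degb me; rewrite !mxE !raddf_sum /=; apply: eq_bigr => a _.
have [->|[f dega Bf]] := bdry_homog a b; first by rewrite !mulr0.
have ef : (e <= f)%N by rewrite -(leq_add2r (target_degree b)) -degb -dega gdeg_low.
rewrite !(mcoeffM_homog _ Bf) ?me//.
have [fe|fe] := eqVneq f e; last first.
  have mf : mdeg m != f by rewrite me eq_sym.
  by rewrite (dhomog_nemf_coeff Bf mf) !mulr0.
have /iotaP[a' <-] : gdeg a = (d + i)%N by rewrite dega fe degb.
congr (_ * _).
rewrite (mulmx_incE iota_inj) {1}/constants mxE mcoeffC eqxx mulr1.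
by rewrite mulmx_incT mxE.
Qed.

Lemma linear_strand_sub_seq : is_linear_strand J d (sub_seq iota).
Proof.
have augd : mxhomog d (gaug (sub_seq iota)).
  move=> a b; rewrite mxE ord1; have [->|[e]] := mfr_aug_homog resG (iota a) 0.
    exact: dhomog0.
  by rewrite gdeg_iota !addn0 => <-.
have diff1 i : mxhomog 1 (gdiff (sub_seq iota) i).
  move=> a b; rewrite mxE.
  by have [->|[]] := gdiff_linear a (iota b); first exact: dhomog0.
split=> //; first exact: gdeg_iota.
- exact: sub_complex iota_inj iota_stable gdiff_complex.
- move=> p pd; rewrite (mfr_image resG); split=> [[v pE]|[c c0 ->]]; last first.
    by exists (c *m inc iota 0); rewrite -mulmxA inc_mulmx.
  have c0 := mxhomog0_const (v *m (inc iota 0)^T).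
  (* In degree [d] only the constant coefficients of generators of degree [d] matter. *)
  exists (constants (v *m (inc iota 0)^T)) => //.
  apply/mpolyP => m; have [md|md] := eqVneq (mdeg m) d.
    rewrite -[gaug _]/(rowsub (@iota 0) (gaug G)) -inc_mulmx mulmxA pE.
    exact: (bdry_low_degree (i := 0) (b := 0) v 0 erefl md).
  rewrite (dhomog_nemf_coeff pd md).
  by rewrite (dhomog_nemf_coeff (mxhomogM c0 augd 0 0) md).
(* A constant cycle is a boundary by exactness, so by minimality its entries have no constant
   term. *)
- move=> i c c0 /(sub_kernel iota_inj iota_stable)/bdry_exact[w wE].
  apply: (mulmx_inc_eq0 iota_inj).
  rewrite -(mxhomog0E (mxhomogM c0 (@mxhomog_inc _ _ _ _ iota _))) wE.
  by apply/matrixP => x b; rewrite /constants mxE gdiff_const mxE mpolyC0.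
- move=> i w w1 /(sub_kernel iota_inj iota_stable)/bdry_exact[w' wE].
  have c0 := mxhomog0_const (w' *m (inc iota i.+1)^T).
  exists (constants (w' *m (inc iota i.+1)^T)) => //.
  apply/matrixP => x b; apply/mpolyP => m; have [m1|m1] := eqVneq (mdeg m) 1%N.
    rewrite -[w x b](mulmx_incE iota_inj) -[in RHS](mulmx_incE iota_inj) wE.
    rewrite -[in RHS]mulmxA -(sub_diff iota_inj iota_stable) mulmxA.
    apply: (bdry_low_degree (i := i.+1) (b := iota b) w' x _ m1).
    by rewrite /= gdeg_iota addnS.
  rewrite (dhomog_nemf_coeff (w1 x b) m1).
  by rewrite (dhomog_nemf_coeff (mxhomogM c0 (diff1 i) x b) m1).
Qed.

End Resolution.

(** * The strand of an induced subcomplex *)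

Lemma graded_iso_ext (k : fieldType) (n : nat) (r : nat -> nat)
    (deg deg' : forall i, 'I_(r i) -> nat)
    (diff diff' : forall i, 'M[{mpoly k[n]}]_(r i.+1, r i)) aug aug' :
  (forall i a, deg i a = deg' i a) -> (forall i, diff i = diff' i) -> aug = aug' ->
  graded_iso (GradedSeq deg diff aug) (GradedSeq deg' diff' aug').
Proof.
move=> degE diffE ->; exists (fun i => 1%:M), (fun i => 1%:M); split=> /=.
- move=> i a b; have [->|ab] := eqVneq a b.
    by right; exists 0%N; rewrite ?degE ?mxE ?eqxx ?dhomog1.
  by left; rewrite mxE (negPf ab).
- by move=> i; rewrite !mulmx1.
- by move=> i; rewrite mulmx1 mul1mx diffE.
- by rewrite mul1mx.
Qed.

Lemma mcoeffMz (k : fieldType) (n : nat) (p : {mpoly k[n]}) (e : int) mu :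
  (p *~ e)@_mu = p@_mu *~ e.
Proof. exact: raddfMz. Qed.

Section ResolutionStrand.
Variables (k : fieldType) (n : nat) (J : {mpoly k[n]} -> Prop) (d : nat).
Variable G : graded_seq k n.
Hypothesis resG : minimal_free_resolution J G.

Lemma is_linear_strand_resolution :
  (forall e p, J p -> p != 0 -> p \is e.-homog -> (d <= e)%N) ->
  is_linear_strand J d (linear_strand d G).
Proof.
move=> Jlow; apply: (linear_strand_sub_seq resG Jlow (iota := fun i => enum_val)).
- by move=> i; exact: enum_val_inj.
move=> i b; split=> [[a <-]|degb].
  by have := enum_valP a; rewrite inE => /eqP.
have bi : b \in [set a | @gdeg _ _ G i a == d + i]%N by rewrite inE degb.
by exists (enum_rank_in bi b); rewrite enum_rankK_in.
Qed.

Lemma is_linear_strand_linear :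
  (forall e p, J p -> p != 0 -> p \is e.-homog -> (d <= e)%N) ->
  (forall i a, @gdeg _ _ G i a = (d + i)%N) ->
  is_linear_strand J d G.
Proof.
move=> Jlow degG.
apply: ls_transport (linear_strand_sub_seq resG Jlow (iota := fun i => id) _ _).
- case: (G) => r deg diff aug; apply: graded_iso_ext => //=.
    by move=> i; rewrite mxsub_id.
  by rewrite mxsub_id.
- by move=> i a b.
- by move=> i b; split=> // _; exists b.
Qed.

(** The basis element [a] ensures that [J] is nonzero: following nonzero boundary entries down to
    index 0 gives a generator whose image is a nonzero form of degree [d]. *)
Lemma initial_degree_linear_resolution i (a : 'I_(grank G i)) :
  (forall j b, @gdeg _ _ G j b = (d + j)%N) -> initial_degree J d.
Proof.
move=> degG; have augd b : gaug G b 0 \is d.-homog.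
  have [->|[e]] := mfr_aug_homog resG b 0; first exact: dhomog0.
  by rewrite degG !addn0 => <-.
split.
  elim: i a => [|i IH] a; last by have [b _] := bdry_row_neq0 resG a; exact: IH b.
  have [b] := bdry_row_neq0 resG a; rewrite (ord1 b) => nz.
  by exists (gaug G a 0); split; [exact: gaug_mem|exact: nz|].
move=> e p /(mfr_image resG)[v ->] nz pe; rewrite leqNgt; apply: contra nz => ed.
apply/eqP/mpolyP => m; rewrite mcoeff0; have [me|me] := eqVneq (mdeg m) e; last first.
  exact: dhomog_nemf_coeff pe me.
have md : mdeg m != d by rewrite me ltn_eqF.
rewrite mxE raddf_sum /= big1 // => b _.
by rewrite (mcoeffM_homog _ (augd b)) ?me 1?ltnW// (dhomog_nemf_coeff (augd b) md) mulr0.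
Qed.

End ResolutionStrand.

(** A nonzero form in [J] forces an initial degree to exist, and it is [d]; for zero [J] the bound
    is vacuous. *)
Lemma initial_degree_low (k : fieldType) (n : nat) (J : {mpoly k[n]} -> Prop) d :
  (forall e, initial_degree J e -> e = d) ->
  forall e p, J p -> p != 0 -> p \is e.-homog -> (d <= e)%N.
Proof.
move=> Jd e p Jp nz pe.
pose Q e := boolp.asbool (exists p, [/\ J p, p != 0 & p \is e.-homog]).
have exQ : exists e, Q e by exists e; apply/boolp.asboolP; exists p.
case: (ex_minnP exQ) => e0 /boolp.asboolP ex0 min0.
have minE e' p' : J p' -> p' != 0 -> p' \is e'.-homog -> (e0 <= e')%N.
  by move=> *; apply: min0; apply/boolp.asboolP; exists p'.
by rewrite -(Jd e0) //; exact: minE Jp nz pe.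
Qed.

(** * Complexes of faces that are linear strands *)

Section CellularStrand.
Variables (k : fieldType) (T : realType) (n : nat) (C : labelled_cw T n).
Local Notation R := {mpoly k[n]}.
Local Notation m := (@multidegree T n C).
Local Notation eps := (@lcw_eps T n C).
Local Notation dim := (@cw_dim T C).
Local Notation K := (cellular_complex k C).
Variables (I : R -> Prop) (d : nat).
Hypothesis lsK : is_linear_strand I d K.

Definition face_of i (a : 'I_(grank K i)) : cw_face C := enum_val a.

Lemma face_of_dim i (a : 'I_(grank K i)) : dim (face_of a) = i.
Proof. by have := enum_valP a; rewrite inE => /eqP. Qed.

Lemma face_ofP i P : dim P = i -> exists a : 'I_(grank K i), face_of a = P.
Proof.
move=> Pi; have PK : P \in [set P : cw_face C | dim P == i] by rewrite inE Pi.
by exists (enum_rank_in PK P); rewrite /face_of enum_rankK_in.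
Qed.

Lemma face_of_inj i : injective (@face_of i).
Proof. exact: enum_val_inj. Qed.

Lemma gdiffE i a b : gdiff K i a b =
  'X_[m (face_of a) - m (face_of b)] *~ eps (face_of b) (face_of a).
Proof. by rewrite mxE. Qed.

Lemma gaugE a : gaug K a 0 = 'X_[m (face_of a)].
Proof. by rewrite mxE. Qed.

Lemma mdeg_multidegree P : mdeg (m P) = (d + dim P)%N.
Proof.
have [a aP] := face_ofP (erefl (dim P)).
by have := ls_deg lsK _ a; rewrite /= -/(face_of a) aP.
Qed.

(** Otherwise the basis element of [P] would be a constant cycle. *)
Lemma face_facet P : (0 < dim P)%N -> exists Q, is_facet Q P.
Proof.
case Ei : (dim P) => [|i] // _; have [a aP] := face_ofP Ei.
apply/existsP; apply: contraT; rewrite negb_exists => /forallP noQ.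
have /matrixP/(_ 0 a) : row a 1%:M = 0 :> 'rV[R]_(grank K i.+1).
  apply: (ls_inj lsK (i := i.+1)); first exact/mxhomog_row/mxhomog1.
  rewrite -row_mul mul1mx; apply/rowP => b; rewrite mxE [LHS]gdiffE mxE aP.
  by have := noQ (face_of b); rewrite -eps_neq0 negbK => /eqP ->; rewrite mulr0z.
by rewrite !mxE eqxx => /eqP; rewrite oner_eq0.
Qed.

(** The basis element of [P'] minus [s] times that of [P] is a constant cycle, hence zero. *)
Lemma face_sign P P' (s : int) : (0 < dim P)%N -> m P = m P' ->
  (forall Q, eps Q P' = s * eps Q P) -> P = P'.
Proof.
case Ei : (dim P) => [|i] // _ mE epsE.
have Ei' : dim P' = i.+1.
  by apply/eqP; rewrite -(eqn_add2l d) -mdeg_multidegree -mE mdeg_multidegree Ei.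
have [a aP] := face_ofP Ei; have [a' aP'] := face_ofP Ei'.
pose c : 'rV[R]_(grank K i.+1) := row a' 1%:M - s%:~R *: row a 1%:M.
have c0 : mxhomog 0 c.
  by move=> x b; rewrite !mxE rpredB ?mulrzl ?rpredMz ?rpredMn ?dhomog1.
have cK : c *m gdiff K i = 0.
  rewrite mulmxBl -scalemxAl -!row_mul mul1mx; apply/rowP => b.
  rewrite !mxE /= -!/(face_of _) aP aP' mE epsE mulrzl mulrC mulrzA.
  by rewrite subrr.
have /matrixP/(_ 0 a') := ls_inj lsK (i := i.+1) c0 cK.
rewrite !mxE eqxx; have [aa'|ne] := eqVneq a a'; first by rewrite -aP -aP' aa'.
by rewrite mulr0 subr0 => /eqP; rewrite oner_eq0.
Qed.

Lemma face_of_label_inj (a b : 'I_(grank K 0)) :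
  m (face_of a) = m (face_of b) -> a = b.
Proof.
move=> mE; apply/eqP; apply: contraT => ab.
have /matrixP/(_ 0 a) : row a 1%:M - row b 1%:M = 0 :> 'rV[R]_(grank K 0).
  apply: (ls_inj lsK (i := 0)).
    exact/mxhomogD/mxhomogN/mxhomog_row/mxhomog1/mxhomog_row/mxhomog1.
  rewrite mulmxBl -!row_mul mul1mx; apply/rowP => x; rewrite ord1 !mxE /=.
  by rewrite -!/(face_of _) mE subrr.
by rewrite !mxE eqxx eq_sym (negPf ab) subr0 => /eqP; rewrite oner_eq0.
Qed.

Hypothesis edgeH : forall E E', dim E = 1%N -> dim E' = 1%N -> m E = m E' -> E = E'.

Section InducedStrand.
Variable X : pred (vertex C).
Local Notation KX := (cellular_complex k (induced X)).

Definition in_induced (P : cw_face C) := [forall v : vertex C, is_face (val v) P ==> X v].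

Lemma multidegree_induced (P : cw_face (induced X)) : multidegree P = m (val P).
Proof.
apply/mnmP => i; apply/eqP; rewrite eqn_leq.
have le1 : (multidegree P <= m (val P))%MM.
  apply/multidegree_leP => v vP.
  exact: ((multidegree_leP (val P) _).1 (lepm_refl _) (induced_vertex v) vP).
have le2 : (m (val P) <= multidegree P)%MM.
  apply/multidegree_leP => v vP.
  have vX : in_induced (val v) by exact: induced_faceS vP (valP P).
  have v0 : cw_dim (Sub (val v) vX : cw_face (induced X)) == 0%N.
    by rewrite /= ?SubK; exact: valP v.
  pose w : vertex (induced X) := Sub (Sub (val v) vX : cw_face (induced X)) v0.
  have <- : induced_vertex w = v by exact: val_inj.
  exact: ((multidegree_leP P _).1 (lepm_refl _) w vP).
by rewrite (mnm_lepP le1) (mnm_lepP le2).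
Qed.

Lemma val_face i (a : 'I_(grank KX i)) :
  val (enum_val a : cw_face (induced X)) \in [set P : cw_face C | dim P == i].
Proof. by have := enum_valP a; rewrite !inE. Qed.

Definition iota_induced i (a : 'I_(grank KX i)) : 'I_(grank K i) :=
  enum_rank_in (val_face a) (val (enum_val a : cw_face (induced X))).

Lemma face_of_iota i (a : 'I_(grank KX i)) :
  face_of (iota_induced a) = val (enum_val a : cw_face (induced X)).
Proof. by rewrite /face_of /iota_induced enum_rankK_in// val_face. Qed.

Lemma iota_induced_inj i : injective (@iota_induced i).
Proof.
move=> a b /(congr1 (@face_of i)); rewrite !face_of_iota => /val_inj.
exact: enum_val_inj.
Qed.

Lemma iota_inducedP i (b : 'I_(grank K i)) :
  (exists a, @iota_induced i a = b) <-> in_induced (face_of b).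
Proof.
split=> [[a <-]|bX].
  by rewrite face_of_iota; exact: valP (enum_val a : cw_face (induced X)).
pose P : cw_face (induced X) := Sub (face_of b) bX.
have PK : P \in [set P : cw_face (induced X) | cw_dim P == i].
  by rewrite inE; apply/eqP/face_of_dim.
exists (enum_rank_in PK P); apply: face_of_inj; rewrite face_of_iota.
by rewrite enum_rankK_in.
Qed.

Lemma induced_graded_iso : graded_iso KX (sub_seq iota_induced).
Proof.
apply: graded_iso_ext => /=.
- by move=> i a; rewrite multidegree_induced -face_of_iota.
- move=> i; apply/matrixP => a b; rewrite !mxE /= !multidegree_induced.
  by rewrite -!face_of_iota.
- by apply/matrixP => a b; rewrite !mxE multidegree_induced -face_of_iota.
Qed.

Lemma iota_induced_stable i a :
  supported iota_induced (row (@iota_induced i.+1 a) (gdiff K i)).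
Proof.
move=> b Nb x; rewrite mxE [LHS]gdiffE.
have [->|] := eqVneq (eps (face_of b) (face_of (iota_induced a))) 0.
  by rewrite mulr0z.
rewrite eps_neq0 => ba; have /iota_inducedP[a' ab] : in_induced (face_of b).
  apply: induced_faceS (facet_face ba) _; apply/iota_inducedP; by exists a.
by have := Nb a'.
Qed.

(** No facet of a face with nonzero coefficient cancels in the boundary, so all of these facets are
    induced; every vertex of the face lies in one of them by [vertex_in_facet]. *)
Lemma supported_induced i (c : 'rV[R]_(grank K i.+1)) : mxhomog 0 c ->
  supported iota_induced (c *m gdiff K i) -> supported iota_induced c.
Proof.
move=> c0 suppc b Nb x; rewrite (ord1 x) => {x}; apply/eqP; apply: contraT => cb.
have key Q : is_facet Q (face_of b) -> in_induced Q.
  move=> Qb; have [q qQ] : exists q : 'I_(grank K i), face_of q = Q.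
    by apply: face_ofP; apply/eq_add_S; rewrite -(facet_dim Qb) face_of_dim.
  rewrite -qQ; apply/iota_inducedP; apply: boolp.contrapT => Nq.
  (* In this monomial, the entry at [Q] only receives contributions from faces with facet [Q] and
     the multidegree of [face_of b], that is from [face_of b] alone. *)
  have /(congr1 (mcoeff (m (face_of b) - m Q)))/eqP :=
    suppc q (fun a aq => Nq (ex_intro _ a aq)) 0.
  rewrite mcoeff0 mxE raddf_sum (bigD1 b) //= big1 => [|b' b'b]; last first.
    rewrite gdiffE qQ -(dhomog0_const (c0 0 b')) mcoeffCM mcoeffMz mcoeffX.
    have [->|] := eqVneq (eps Q (face_of b')) 0; first by rewrite mulr0z mulr0.
    rewrite eps_neq0 => Qb'; case: eqP => [E|_]; last by rewrite mul0rz mulr0.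
    case/eqP: b'b; apply: face_of_inj.
    apply: (facet_degree_inj mdeg_multidegree edgeH face_facet face_sign Qb' Qb).
    rewrite -(submK (multidegreeS (facet_face Qb'))) E submK//.
    exact: multidegreeS (facet_face Qb).
  rewrite addr0 gdiffE qQ -(dhomog0_const (c0 0 b)) mcoeffCM mcoeffMz mcoeffX eqxx.
  rewrite mulf_eq0 => /orP[/eqP cb0|].
    by rewrite -(dhomog0_const (c0 0 b)) cb0 mpolyC0 eqxx in cb.
  (* The incidence number is a unit of the integers, so it is nonzero in [k] whatever the
     characteristic. *)
  move=> /eqP/(congr1 ( *~%R^~ (eps Q (face_of b)))).
  by rewrite -mulrzA eps_sqr// mul0rz => /eqP; rewrite oner_eq0.
suff /iota_inducedP[a ab] : in_induced (face_of b) by have := Nb a.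
apply/forallP => v; apply/implyP => vb.
have [||Q Qb vQ] := vertex_in_facet mdeg_multidegree edgeH face_facet face_sign _ _ vb.
- by rewrite face_of_dim.
- exact/eqP/(valP v).
by have /forallP/(_ v)/implyP := key Q Qb; exact.
Qed.

End InducedStrand.

Variable J : R -> Prop.
Hypothesis monI : monomial_ideal I.
Hypothesis monJ : monomial_ideal J.
Hypothesis JI : forall mu, mingens J mu -> mingens I mu.
Hypothesis Jlow : forall e p, J p -> p != 0 -> p \is e.-homog -> (d <= e)%N.

Lemma in_induced_vertex (b : 'I_(grank K 0)) :
  in_induced (label_in (C := C) (mingens J)) (face_of b) <-> mingens J (m (face_of b)).
Proof.
have b0 : dim (face_of b) == 0%N by rewrite face_of_dim.
pose v : vertex C := Sub (face_of b) b0.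
have mE : m (face_of b) = lcw_label v by rewrite -multidegree_vertex.
rewrite mE; split=> [/forallP/(_ v)/implyP/(_ (is_face_refl _))/boolp.asboolP//|Jv].
apply/forallP => w; apply/implyP => /(vertex_faceP (face_of_dim b)) wb.
by apply/boolp.asboolP; rewrite (_ : w = v)//; exact: val_inj.
Qed.

Lemma is_linear_strand_induced :
  is_linear_strand J d (cellular_complex k (induced (label_in (C := C) (mingens J)))).
Proof.
apply: ls_transport (induced_graded_iso _) _.
apply: (ls_sub_seq (@iota_induced_inj _) (@iota_induced_stable _) lsK);
  last exact: supported_induced.
move=> p pd; split=> [Jp|[c [c0 suppc] ->]].
  (* No element of [J] has degree less than [d], so its monomials of degree [d] are minimal
     generators. *)
  have Jm mu : mu \in msupp p -> mingens J mu.
    move=> mup; apply: (mingens_low_degree monJ Jlow).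
      exact: (monomial_idealP monJ p).1.
    exact: dhomog_mf pd _ mup.
  have /(ls_image lsK pd)[c c0 pE] : I p.
    by apply/(monomial_idealP monI) => mu /Jm/JI/mingens_mem.
  exists c => //; split=> // b Nb x; rewrite (ord1 x) => {x}.
  apply/eqP; apply: contraT => cb.
  (* Distinct vertices have distinct labels, so the label of a vertex with nonzero coefficient
     cannot cancel in [p]. *)
  suff /Jm/in_induced_vertex/iota_inducedP[a ab] : m (face_of b) \in msupp p.
    by have := Nb a.
  rewrite mcoeff_msupp pE mxE raddf_sum (bigD1 b) //= big1 => [|b' b'b].
    rewrite addr0 gaugE -(dhomog0_const (c0 0 b)) mcoeffCM mcoeffX eqxx mulr1.
    by apply: contraNneq cb => cb0; rewrite -(dhomog0_const (c0 0 b)) cb0 mpolyC0.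
  rewrite gaugE -(dhomog0_const (c0 0 b')) mcoeffCM mcoeffX.
  case: eqP => [/face_of_label_inj E|_]; last by rewrite mulr0.
  by rewrite E eqxx in b'b.
apply/(monomial_idealP monJ) => mu; rewrite mcoeff_msupp mxE raddf_sum => nz.
have [b] : exists b, (c 0 b * gaug K b 0)@_mu != 0.
  apply/existsP; apply: contraNT nz; rewrite negb_exists => /forallP z.
  by rewrite big1 // => b _; apply/eqP/negPn/z.
rewrite gaugE -{1}(dhomog0_const (c0 0 b)) mcoeffCM mcoeffX mulf_eq0 negb_or.
have [<-|_] := eqVneq (m (face_of b)) mu; last by rewrite eqxx andbF.
move=> /andP[cb _]; apply: mingens_mem; apply/in_induced_vertex/iota_inducedP.
apply: boolp.contrapT => Nb; case/eqP: cb.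
by rewrite (suppc b) ?mcoeff0 // => a ab; apply: Nb; exists a.
Qed.

End CellularStrand.

(* [T] is the field of real numbers used by the topological notions. The strands
   of [I] and [J] start in the same degree [d], so that the generators of [J] in
   its initial degree correspond to vertices of [P]; [I] need not be generated in
   degree [d], and [J] may be zero. *)
Theorem theorem3p20 (T : realType) (k : fieldType) (n : nat)
    (P : labelled_cw T n)
    (I J : {mpoly k[n]} -> Prop) (d : nat) (F : graded_seq k n)
    (hI : monomial_ideal I)
    (hd : initial_degree I d)
    (hF : minimal_free_resolution I F)
    (hP : supports P (linear_strand d F))
    (hedge : forall E E' : cw_face P, cw_dim E = 1%N -> cw_dim E' = 1%N ->
       multidegree E = multidegree E' -> E = E')
    (hJ : monomial_ideal J)
    (hJI : forall m, mingens J m -> mingens I m)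
    (hJd : forall e, initial_degree J e -> e = d) :
  (forall G : graded_seq k n, minimal_free_resolution J G ->
     supports (induced (label_in (C := P) (mingens J))) (linear_strand d G)) /\
  (has_linear_resolution J -> has_cw_resolution T J).
Proof.
have lsP : is_linear_strand I d (cellular_complex k P).
  exact: ls_transport hP (is_linear_strand_resolution hF hd.2).
have Jlow := initial_degree_low hJd.
have lsJ := is_linear_strand_induced lsP hedge hI hJ hJI Jlow.
split=> [G resG|[d' [G [resG degG]]]].
  exact: ls_unique lsJ (is_linear_strand_resolution resG Jlow).
exists G; split=> //; exists (induced (label_in (C := P) (mingens J))).
apply: ls_unique lsJ (is_linear_strand_linear resG Jlow _) => i a.
(* The equality of [d'] and [d] is only required when [G] has a basis element [a]; then [J] is
   nonzero and [d'] is its initial degree. *)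
by rewrite degG (hJd d')//; exact: initial_degree_linear_resolution resG _ a degG.
Qed.
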